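(* Let $n\ge1$ and let $\varphi\in\mathcal{F}(\mathbb{C}^n)$. If $S_\varphi$ is bounded on $\mathcal{F}(\mathbb{C}^n)$, then for every $t$ with $0\le t<1/2$, $$\int_{\mathbb{R}^n}\int_{\mathbb{R}^n}|\varphi(x+iy)|^2\,w_t(x,y)\,dx\,dy<\infty,$$ where $$w_t(x,y)=e^{-\frac12(|x|^2+|y|^2)}\,e^{\frac{2t}{1+2t}|y|^2}.$$
   Context: For $z,w\in\mathbb{C}^n$ write $z\cdot w=\sum_j z_jw_j$, $|z|^2=z\cdot\bar z$; $dz$ denotes Lebesgue measure on $\mathbb{C}^n\cong\mathbb{R}^{2n}$. The Fock space $\mathcal{F}(\mathbb{C}^n)$ is the Hilbert space of all entire functions $F$ on $\mathbb{C}^n$ with $\|F\|^2=\int_{\mathbb{C}^n}|F(z)|^2w_0(z)\,dz<\infty$, where $w_0(z)=c_0e^{-\frac12|z|^2}$ and $c_0=(2\pi)^{-n}$ makes $w_0(z)dz$ a probability measure. (In this context $w_0(z)$ with a complex argument is this Gaussian weight.) Its reproducing kernel is $e^{\frac12 z\cdot\bar w}$. For $\varphi\in\mathcal{F}(\mathbb{C}^n)$ the operator $S_\varphi$ is given by $$S_\varphi F(z)=\int_{\mathbb{C}^n}F(w)\,\varphi(z-\bar w)\,e^{\frac12 z\cdot\bar w}\,w_0(w)\,dw,$$ initially for $F$ in the dense subspace $\mathcal{D}$ spanned by the functions $w\mapsto e^{\frac12 w\cdot\bar a}$, $a\in\mathbb{C}^n$. ''$S_\varphi$ is bounded on $\mathcal{F}(\mathbb{C}^n)$''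 means that $S_\varphi$ extends from $\mathcal{D}$ to a bounded linear operator on $\mathcal{F}(\mathbb{C}^n)$, i.e. $S_\varphi F\in\mathcal{F}(\mathbb{C}^n)$ and $\|S_\varphi F\|\le C\|F\|$ for all $F\in\mathcal{D}$, with $C$ independent of $F$. *)

(* Defs.v *)
From HB Require Import structures.
From mathcomp Require Import all_boot all_order all_algebra.
From mathcomp Require Import complex.
From mathcomp Require Import all_classical all_reals all_analysis.
Set Implicit Arguments.
Unset Strict Implicit.
Unset Printing Implicit Defensive.
Import Order.TTheory GRing.Theory Num.Theory.
Import numFieldNormedType.Exports.
Local Open Scope classical_set_scope.
Local Open Scope ring_scope.
Local Open Scope complex_scope.

(* n-fold product of a sigma-finite measure, built on [n.-tuple T] by
   transporting the binary product on [T * n.-tuple T] along [tuple_cons]. *)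
Definition tuple_cons d (T : measurableType d) n (p : T * n.-tuple T) :
  n.+1.-tuple T := [tuple of p.1 :: p.2].

Definition tuple_uncons d (T : measurableType d) n (t : n.+1.-tuple T) :
  T * n.-tuple T := (thead t, [tuple of behead t]).

Lemma tuple_consK d (T : measurableType d) n :
  cancel (@tuple_cons d T n) (@tuple_uncons d T n).
Proof.
by case=> a s; rewrite /tuple_uncons theadE; congr (_, _); exact/val_inj.
Qed.

Lemma measurable_tuple_cons d (T : measurableType d) n :
  measurable_fun setT (@tuple_cons d T n).
Proof. exact: measurable_cons. Qed.

Lemma measurable_tuple_uncons d (T : measurableType d) n :
  measurable_fun setT (@tuple_uncons d T n).
Proof.
by apply: measurable_fun_pair; [exact: measurable_tnth|exact: measurable_behead].
Qed.

(* The general instance for [m1 \x m2] in the library cannot be inferred: it is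
   shadowed by the one for products of subprobabilities. *)
Lemma product_sigma_finite d1 d2 (T1 : measurableType d1)
    (T2 : measurableType d2) (R : realType)
    (m1 : {sigma_finite_measure set T1 -> \bar R})
    (m2 : {sigma_finite_measure set T2 -> \bar R}) :
  sigma_finite setT (m1 \x m2)%E.
Proof.
have /sigma_finiteP[F [TF ndF Foo]] := sigma_finiteT m1.
have /sigma_finiteP[G [TG ndG Goo]] := sigma_finiteT m2.
exists (fun n => F n `*` G n).
  rewrite -setXTT TF TG predeqE => -[x y]; split.
    move=> [/= [n _ Fnx] [k _ Gky]]; exists (maxn n k) => //; split.
    - by move: x Fnx; exact/subsetPset/ndF/leq_maxl.
    - by move: y Gky; exact/subsetPset/ndG/leq_maxr.
  by move=> [n _ []/= ? ?]; split; exists n.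
move=> k; have [? ?] := Foo k; have [? ?] := Goo k.
split; first exact: measurableX.
by rewrite product_measure1E// lte_mul_pinfty// ge0_fin_numE.
Qed.

Section product_tuple.
Context d (T : measurableType d) (R : realType).
Variable m : {sigma_finite_measure set T -> \bar R}.

Section step.
Variables (n : nat) (mu : {sigma_finite_measure set (n.-tuple T) -> \bar R}).

Definition product_cons : set (n.+1.-tuple T) -> \bar R :=
  pushforward (m \x mu)%E (@tuple_cons d T n).

Let pm : {measure set (n.+1.-tuple T) -> \bar R} :=
  measure_function_pushforward__canonical__measure_function_Measure
    (m \x mu)%E (@measurable_tuple_cons d T n).

HB.instance Definition _ := isMeasure.Build _ _ _ product_cons
  (measure0 pm) (measure_ge0 pm) (@measure_semi_sigma_additive _ _ _ pm).

Lemma product_cons_sigma_finite : sigma_finite setT product_cons.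
Proof.
have [F FT mF] := product_sigma_finite m mu.
exists (fun i => @tuple_uncons d T n @^-1` F i).
  by rewrite -preimage_bigcup -FT preimage_setT.
move=> i; have [mFi Fi] := mF i; split.
  by rewrite -[X in measurable X]setTI; exact: measurable_tuple_uncons.
rewrite /product_cons /pushforward -comp_preimage.
rewrite (_ : _ @^-1` _ = F i)//.
by apply/seteqP; split => p /=; rewrite tuple_consK.
Qed.

HB.instance Definition _ := Measure_isSigmaFinite.Build _ _ _ product_cons
  product_cons_sigma_finite.

End step.

Fixpoint product_tuple n : {sigma_finite_measure set (n.-tuple T) -> \bar R} :=
  if n is k.+1 then product_cons (product_tuple k)
  else \d_([tuple] : 0.-tuple T).

End product_tuple.

Definition lebesgue_Rn (R : realType) n :
    {sigma_finite_measure set (n.-tuple (measurableTypeR R)) -> \bar R} :=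
  product_tuple (@lebesgue_measure R) n.

Section lebesgue_Cn.
Variables (R : realType) (n : nat).

(* C^n is identified with R^n * R^n; a pair (x, y) stands for [cvec x y]. *)
Definition lebesgue_Cn :
    set (n.-tuple (measurableTypeR R) * n.-tuple (measurableTypeR R))%type ->
    \bar R :=
  (lebesgue_Rn R n \x lebesgue_Rn R n)%E.

HB.instance Definition _ := Measure.on lebesgue_Cn.

HB.instance Definition _ := Measure_isSigmaFinite.Build _ _ _ lebesgue_Cn
  (product_sigma_finite (lebesgue_Rn R n) (lebesgue_Rn R n)).

End lebesgue_Cn.

Arguments lebesgue_Cn : clear implicits.

Section fock_space.
Variable R : realType.
Local Notation C := R[i].
Local Notation normc := ComplexField.Normc.normc.
Implicit Type n : nat.

(* x + iy *)
Definition cvec n (x y : n.-tuple R) : 'rV[C]_n :=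
  \row_j (tnth x j +i* tnth y j).

Definition conjv n (z : 'rV[C]_n) : 'rV[C]_n := map_mx conjc z.

(* The bilinear dot product: no conjugation. *)
Definition dotc n (z w : 'rV[C]_n) : C := \sum_j z 0 j * w 0 j.

Definition sqnormc n (z : 'rV[C]_n) : R := complex.Re (dotc z (conjv z)).

Definition sqnormr n (x : n.-tuple R) : R := \sum_j tnth x j ^+ 2.

Definition cexp (z : C) : C :=
  (expR (complex.Re z))%:C * (cos (complex.Im z) +i* sin (complex.Im z)).

Definition integral_Cn n (f : 'rV[C]_n -> \bar R) : \bar R :=
  (\int[lebesgue_Cn R n]_p f (cvec p.1 p.2))%E.

Definition cintegral_Cn n (f : 'rV[C]_n -> C) : C :=
  (\int[lebesgue_Cn R n]_p complex.Re (f (cvec p.1 p.2))) +i*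
  (\int[lebesgue_Cn R n]_p complex.Im (f (cvec p.1 p.2))).

(* [C^o] is [C] as a normed module over itself, so this is complex
   differentiability. *)
Definition entire n (F : 'rV[C]_n -> C) : Prop :=
  forall z : 'rV[C^o]_n, differentiable (F : 'rV[C^o]_n -> C^o) z.

Definition w0 n (z : 'rV[C]_n) : R :=
  (2 * pi) ^- n * expR (- (2^-1 * sqnormc z)).

Definition fock_norm n (F : 'rV[C]_n -> C) : \bar R :=
  sqrte (integral_Cn (fun z => (normc (F z) ^+ 2 * w0 z)%:E)).

Definition fock n (F : 'rV[C]_n -> C) : Prop :=
  entire F /\ (fock_norm F < +oo)%E.

Definition fock_kernel n (a w : 'rV[C]_n) : C :=
  cexp (2^-1 * dotc w (conjv a)).

Definition kernel_span n (F : 'rV[C]_n -> C) : Prop :=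
  exists (m : nat) (c : 'I_m -> C) (a : 'I_m -> 'rV[C]_n),
    forall w, F w = \sum_(k < m) c k * fock_kernel (a k) w.

Definition S_op n (phi F : 'rV[C]_n -> C) (z : 'rV[C]_n) : C :=
  cintegral_Cn (fun w =>
    F w * phi (z - conjv w) * cexp (2^-1 * dotc z (conjv w)) * (w0 w)%:C).

Definition S_op_bounded n (phi : 'rV[C]_n -> C) : Prop :=
  exists c : R, forall F, kernel_span F ->
    fock (S_op phi F) /\ (fock_norm (S_op phi F) <= c%:E * fock_norm F)%E.

Definition w_t n (t : R) (x y : n.-tuple R) : R :=
  expR (- (2^-1 * (sqnormr x + sqnormr y))) *
  expR ((2 * t) / (1 + 2 * t) * sqnormr y).

End fock_space.

(* Main.v *)
From HB Require Import structures.
Require Import Defs.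
From mathcomp Require Import all_boot all_order all_algebra.
From mathcomp Require Import complex.
From mathcomp Require Import all_classical all_reals all_analysis.
From mathcomp Require Import measurable_realfun.
From mathcomp Require Import ring lra.
Set Implicit Arguments.
Unset Strict Implicit.
Unset Printing Implicit Defensive.
Import Order.TTheory GRing.Theory Num.Theory.
Import numFieldNormedType.Exports.
Local Open Scope classical_set_scope.
Local Open Scope ring_scope.
Local Open Scope complex_scope.

(** Write [K_a] for the kernel [w |-> e^(w . conj a / 2)] and [kappa] for the
    integral of [w0].  The operator maps kernels to translates of the symbol:
      [S_phi K_a (z) = kappa e^(z . conj a / 2) phi (z - conj a)]
    ([S_op_kernel]).  Testing boundedness on [K_a] for a purely imaginary
    [a = i q] and substituting [z = u + conj a], [u = x + i y], gives
      [int |phi u|^2 w0 u e^(2 q . y) du <= M e^(2 |q|^2)] for all real [q]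
    ([exponential_moment]).  Multiply by [e^(- s |q|^2)] with [s > 2] and
    integrate over [q]: the right-hand side stays finite, and on the left
    Tonelli's theorem and
      [int e^(2 q . y - s |q|^2) dq = K e^(|y|^2 / s)]
    produce the weight [e^(|y|^2 / s)] ([gaussian_moment]).  Here [1 / s] is any
    number in (0, 1/2), and [2 t / (1 + 2 t) < 1/2] exactly when [t < 1/2].

    The formula for [S_phi K_a] is a mean value property.  In the variable
    [zeta = conj (a - w)] the integrand is [E zeta * w0 zeta] with [E] entire
    ([S_op_integrand]), and the Gaussian mean of an entire function is its value
    at 0 times [kappa]: Lebesgue measure on C^n is invariant under
    [zeta |-> e^(i t) zeta], because a plane rotation is a product of three
    shears ([measure_preserving_cmul]), and for fixed [zeta] the mean of
    [t |-> E (e^(i t) zeta)] over a period is [E 0] ([circle_mean]); Fubini's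
    theorem combines the two ([radial_mean]).

    An entire function is only assumed to be complex differentiable at every
    point, so [circle_mean] rests on Goursat's bisection argument
    ([green_rectangle]).  It is applied to [g (e^(s + i t))] on the rectangle
    [[s1, s2] * [0, 2 pi]]: the sides [t = 0] and [t = 2 pi] cancel, hence the
    mean of [g] over a circle does not depend on the radius. *)

(** * Measure-preserving maps of R^n and C^n *)

Section measure_preserving.
Context d (T : measurableType d) (R : realType).
Implicit Type mu : {measure set T -> \bar R}.

Definition measure_preserving (mu : set T -> \bar R) (f : T -> T) : Prop :=
  measurable_fun setT f /\
  forall A, measurable A -> mu (f @^-1` A) = mu A.

Lemma measure_preserving_comp mu f g :
  measure_preserving mu f -> measure_preserving mu g ->
  measure_preserving mu (f \o g).
Proof.
move=> [mf fE] [mg gE]; split; first exact: measurableT_comp.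
move=> A mA; rewrite comp_preimage gE ?fE//.
by rewrite -[X in measurable X]setTI; exact: mf.
Qed.

Lemma ge0_integral_preserving mu f (F : T -> \bar R) :
  measure_preserving mu f -> measurable_fun setT F -> (forall x, 0 <= F x)%E ->
  (\int[mu]_x F (f x) = \int[mu]_x F x)%E.
Proof.
move=> [mf fE] mF F0.
have := @ge0_integral_pushforward _ _ _ _ _ f mf mu setT F measurableT.
move=> /(_ mF (fun x _ => F0 x)); rewrite preimage_setT => <-.
apply: eq_measure_integral => A mA _; exact: fE.
Qed.

Lemma integral_preserving mu f (F : T -> \bar R) :
  measure_preserving mu f -> measurable_fun setT F ->
  (\int[mu]_x F (f x) = \int[mu]_x F x)%E.
Proof.
move=> mpf mF; rewrite -[LHS]/(\int[mu]_x (F \o f) x)%E.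
rewrite integralE [RHS]integralE funepos_comp funeneg_comp.
have h1 := ge0_integral_preserving mpf (measurable_funepos mF) (funepos_ge0 F).
have h2 := ge0_integral_preserving mpf (measurable_funeneg mF) (funeneg_ge0 F).
by congr (_ - _)%E; [exact: h1|exact: h2].
Qed.

End measure_preserving.

Section product_preserving.
Context d1 d2 (T1 : measurableType d1) (T2 : measurableType d2) (R : realType).
Variable m1 : {sigma_finite_measure set T1 -> \bar R}.
Variable m2 : {sigma_finite_measure set T2 -> \bar R}.

(** The product measure of a set is the integral of the measures of its
    sections, and the section at [x] of the preimage is the preimage under
    [g x] of the section at [f x].  Shears, where [g] depends on [x], are the
    reason for not stating this for products of maps only. *)
Lemma measure_preserving_skew (f : T1 -> T1) (g : T1 -> T2 -> T2) :
  measure_preserving m1 f -> (forall x, measure_preserving m2 (g x)) ->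
  measurable_fun setT (fun p : T1 * T2 => (f p.1, g p.1 p.2)) ->
  measure_preserving (m1 \x m2)%E (fun p => (f p.1, g p.1 p.2)).
Proof.
move=> mpf mpg mfg; split=> // A mA.
rewrite [RHS]/(\int[m1]_x m2 (xsection A x))%E.
have := ge0_integral_preserving mpf (measurable_fun_xsection m2 mA).
move=> /(_ (fun=> measure_ge0 _ _)) E.
apply: etrans E; apply: eq_integral => x _ /=.
rewrite -[RHS](mpg x).2; last exact: measurable_xsection.
by congr (m2 _); apply/seteqP; split => y /=; rewrite /xsection /= !inE.
Qed.

End product_preserving.

Lemma measure_preserving_swap d (T : measurableType d) (R : realType)
    (m : {sigma_finite_measure set T -> \bar R}) :
  measure_preserving (m \x m)%E (fun p => (p.2, p.1)).
Proof.
have ms : measurable_fun setT (fun p : T * T => (p.2, p.1)).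
  exact: measurable_swap.
split=> // A mA; apply/esym.
pose m' : {measure set _ -> \bar R} :=
  measure_function_pushforward__canonical__measure_function_Measure
    (m \x m)%E ms.
apply: (product_measure_unique (m1 := m) (m2 := m) (m' := m')) => //.
move=> B C mB mC; rewrite muleC -product_measure1E//.
by congr ((m \x m)%E _); apply/seteqP; split => -[x y] [].
Qed.

Section lebesgue_preserving.
Variable R : realType.
Local Notation T := (measurableTypeR R).
Local Notation mu := (@lebesgue_measure R).

Lemma lebesgue_measure_translation (c : R) :
  measure_preserving mu (fun x : T => x + c : T).
Proof.
have mc : measurable_fun setT (fun x : T => x + c : T).
  by apply: measurable_funD => //; exact: measurable_id.
split=> // A mA; apply/esym.
pose m' : {measure set _ -> \bar R} :=
  measure_function_pushforward__canonical__measure_function_Measure mu mc.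
rewrite (lebesgue_measure_unique (mu := m')) => //.
move=> _ [[a b] _ <-] /=; rewrite /pushforward.
rewrite (_ : _ @^-1` _ = `]a - c, b - c]%classic); last first.
  by apply/seteqP; split => x /=; rewrite !in_itv/= ltrBlDr lerBrDr.
rewrite !lebesgue_measure_itv/= !lte_fin ltrD2r.
by case: ifP => // _; rewrite -!EFinB; congr EFin; lra.
Qed.

Lemma lebesgue_measure_reflection :
  measure_preserving mu (fun x : T => - x : T).
Proof.
have mc : measurable_fun setT (fun x : T => - x : T).
  by apply: measurable_funN; exact: measurable_id.
split=> // A mA; apply/esym.
pose m' : {measure set _ -> \bar R} :=
  measure_function_pushforward__canonical__measure_function_Measure mu mc.
rewrite (lebesgue_measure_unique (mu := m')) => //.
move=> _ [[a b] _ <-] /=; rewrite /pushforward.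
rewrite (_ : _ @^-1` _ = `[- b, - a[%classic); last first.
  by apply/seteqP; split => x /=; rewrite !in_itv/= ltrNr lerNl andbC.
rewrite !lebesgue_measure_itv/= !lte_fin ltrN2.
by case: ifP => // _; rewrite -!EFinB; congr EFin; lra.
Qed.

Definition map_coords n (h : 'I_n -> T -> T) (x : n.-tuple T) : n.-tuple T :=
  [tuple h i (tnth x i) | i < n].

Lemma lebesgue_Rn_coordinatewise n (h : 'I_n -> T -> T) :
  (forall i, measure_preserving mu (h i)) ->
  measure_preserving (lebesgue_Rn R n) (map_coords h).
Proof.
elim: n h => [|n IH] h mph.
  split.
    by apply/measurable_fun_tnthP => -[].
  move=> A mA; congr (_ _); apply/seteqP; split => x /=;
    by rewrite (tuple0 (map_coords _ _)) (tuple0 x).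
have mh : measurable_fun setT (map_coords h).
  apply/measurable_fun_tnthP => i.
  rewrite (_ : _ \o _ = fun x => h i (tnth x i)); last first.
    by apply/funext => x /=; rewrite tnth_mktuple.
  by apply: measurableT_comp; [case: (mph i)|exact: measurable_tnth].
split=> // A mA.
have IHh := IH _ (fun i => mph (lift ord0 i)).
have mph' : measurable_fun setT (fun p : T * n.-tuple T =>
    (h ord0 p.1, map_coords (fun i => h (lift ord0 i)) p.2)).
  apply: measurable_fun_pair.
    by apply: measurableT_comp => //; case: (mph ord0).
  by apply: measurableT_comp => //; case: IHh.
have [_ mpp] := measure_preserving_skew (mph ord0) (fun=> IHh) mph'.
rewrite /lebesgue_Rn /= /product_cons /pushforward -[RHS]mpp; last first.
  rewrite -[X in measurable X]setTI.
  exact: (@measurable_tuple_cons _ T n _ A mA).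
have mapE p : map_coords h (tuple_cons p) =
    tuple_cons (h ord0 p.1, map_coords (fun i => h (lift ord0 i)) p.2).
  apply: eq_from_tnth => i; rewrite tnth_mktuple.
  by have [j ->|->] := unliftP ord0 i; rewrite ?tnthS ?tnth0 ?tnth_mktuple.
by congr (_ _); apply/seteqP; split => p /=; rewrite mapE.
Qed.

Lemma lebesgue_Rn_translation n (c : n.-tuple R) :
  measure_preserving (lebesgue_Rn R n) (map_coords (fun i x => x + tnth c i)).
Proof.
by apply: lebesgue_Rn_coordinatewise => i; exact: lebesgue_measure_translation.
Qed.

Lemma lebesgue_Rn_reflection n :
  measure_preserving (lebesgue_Rn R n) (map_coords (fun _ x => - x)).
Proof.
by apply: lebesgue_Rn_coordinatewise => i; exact: lebesgue_measure_reflection.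
Qed.

End lebesgue_preserving.

Section Cn_preserving.
Variables (R : realType) (n : nat).
Local Notation T := (measurableTypeR R).
Local Notation Tn := (n.-tuple T).
Implicit Types (p : Tn * Tn) (a b c s : R).

Lemma measurable_coord d (X : measurableType d) (u : X -> Tn) i :
  measurable_fun setT u -> measurable_fun setT (fun x => tnth (u x) i).
Proof.
apply: (measurableT_comp (f := fun y : Tn => tnth y i)).
exact: measurable_tnth.
Qed.

Lemma measurable_lincomb d (X : measurableType d) (f g : X -> T)
    (u v : X -> Tn) :
  measurable_fun setT f -> measurable_fun setT g ->
  measurable_fun setT u -> measurable_fun setT v ->
  measurable_fun setT
    (fun x => [tuple f x * tnth (u x) i + g x * tnth (v x) i | i < n] : Tn).
Proof.
move=> mf mg mu mv; apply/measurable_fun_tnthP => i.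
rewrite (_ : _ \o _ = fun x => f x * tnth (u x) i + g x * tnth (v x) i);
  last first.
  by apply/funext => x /=; rewrite tnth_mktuple.
by apply: measurable_funD; apply: measurable_funM => //;
  exact: measurable_coord.
Qed.

Lemma measurable_Cn_lincomb a b : measurable_fun setT
  (fun p : Tn * Tn => [tuple a * tnth p.1 i + b * tnth p.2 i | i < n] : Tn).
Proof. exact: measurable_lincomb. Qed.

Definition shear s p : Tn * Tn :=
  (p.1, [tuple s * tnth p.1 i + tnth p.2 i | i < n]).

Lemma measure_preserving_shear s :
  measure_preserving (@lebesgue_Cn R n) (shear s).
Proof.
rewrite /shear.
apply: (@measure_preserving_skew _ _ _ _ _ (lebesgue_Rn R n) (lebesgue_Rn R n) id
  (fun x y => [tuple s * tnth x i + tnth y i | i < n])).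
- by split.
- move=> x; rewrite (_ : (fun y => _) =
      map_coords (fun i y => y + tnth [tuple s * tnth x i | i < n] i)).
    exact: lebesgue_Rn_translation.
  by apply/funext => y; apply: eq_from_tnth => i; rewrite !tnth_mktuple addrC.
- apply: measurable_fun_pair => //.
  under eq_fun do under eq_mktuple do rewrite -[tnth _.2 _]mul1r.
  exact: measurable_Cn_lincomb.
Qed.

(** Multiplication by [c + i s] in the real coordinates [(x, y)] of C^n. *)
Definition cmul c s p : Tn * Tn :=
  ([tuple c * tnth p.1 i + (- s) * tnth p.2 i | i < n],
   [tuple s * tnth p.1 i + c * tnth p.2 i | i < n]).

Definition reflect_fst p : Tn * Tn := ([tuple - tnth p.1 i | i < n], p.2).

Lemma measure_preserving_reflect_fst :
  measure_preserving (@lebesgue_Cn R n) reflect_fst.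
Proof.
apply: (@measure_preserving_skew _ _ _ _ _ (lebesgue_Rn R n) (lebesgue_Rn R n)
  (map_coords (fun _ x => - x))
  (fun=> id)).
- exact: lebesgue_Rn_reflection.
- by split.
- apply: measurable_fun_pair => //.
  by apply: measurableT_comp => //; case: (lebesgue_Rn_reflection R n).
Qed.

Definition translate (d : Tn * Tn) p : Tn * Tn :=
  ([tuple tnth p.1 i + tnth d.1 i | i < n],
   [tuple tnth p.2 i + tnth d.2 i | i < n]).

Lemma measure_preserving_translate d :
  measure_preserving (@lebesgue_Cn R n) (translate d).
Proof.
have mt x := @lebesgue_Rn_translation R n x.
apply: (@measure_preserving_skew _ _ _ _ _ (lebesgue_Rn R n) (lebesgue_Rn R n)
  (map_coords (fun i x => x + tnth d.1 i))
  (fun=> map_coords (fun i x => x + tnth d.2 i))) => //.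
apply: measurable_fun_pair.
  exact: (measurableT_comp (mt d.1).1 measurable_fst).
exact: (measurableT_comp (mt d.2).1 measurable_snd).
Qed.

(** A rotation with [c <> -1] is the product of three shears, alternately in
    the two coordinates, with parameters [a], [s] and [a], where
    [a = - s / (1 + c)] is minus the tangent of the half angle; the remaining
    rotation is [-1], a product of reflections. *)
Lemma measure_preserving_cmul c s : c ^+ 2 + s ^+ 2 = 1 ->
  measure_preserving (@lebesgue_Cn R n) (cmul c s).
Proof.
pose swap p := (p.2, p.1).
have mpswap : measure_preserving (@lebesgue_Cn R n) swap.
  exact: measure_preserving_swap.
have mpC f g mpf mpg :=
  @measure_preserving_comp _ _ _ (lebesgue_Cn R n) f g mpf mpg.
have [->|c1] := eqVneq c (- 1).
  rewrite sqrrN expr1n => /eqP.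
  rewrite -subr_eq0 addrC addKr sqrf_eq0 => /eqP ->.
  rewrite (_ : cmul _ _ = swap \o reflect_fst \o swap \o reflect_fst).
    have mpr := measure_preserving_reflect_fst.
    exact: mpC (mpC _ _ (mpC _ _ mpswap mpr) mpswap) mpr.
  apply/funext => p; congr (_, _); apply: eq_from_tnth => i;
    by rewrite !tnth_mktuple/=; ring.
move=> cs1; pose a := - s / (1 + c).
have c10 : 1 + c != 0 by rewrite addrC addr_eq0.
have as1 : 1 + a * s = c.
  apply: (mulIf c10).
  have -> : (1 + a * s) * (1 + c) = 1 + c + s * (a * (1 + c)) by ring.
  by rewrite /a divfK// -{1}cs1; ring.
have aac : a + a * c = - s by rewrite /a; field.
rewrite (_ : cmul c s =
  (swap \o shear a) \o (swap \o shear s) \o (swap \o shear a) \o swap).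
  have mps := measure_preserving_shear.
  have mpsws c' := mpC _ _ mpswap (mps c').
  exact: mpC (mpC _ _ (mpC _ _ (mpsws a) (mpsws s)) (mpsws a)) mpswap.
apply/funext => p; congr (_, _); apply: eq_from_tnth => i;
  rewrite !tnth_mktuple/=.
  by rewrite -aac -as1; ring.
by rewrite -as1; ring.
Qed.

End Cn_preserving.

(** * Goursat's argument on rectangles *)

Section goursat.
Variable R : realType.

Lemma nested_intervals (u : nat -> R) (H : R) :
  (forall k, u k <= u k.+1) ->
  (forall k, u k.+1 + H / 2 ^+ k.+1 <= u k + H / 2 ^+ k) -> 0 <= H ->
  exists x, forall k, u k <= x <= u k + H / 2 ^+ k.
Proof.
move=> u1 u2 H0.
have incr i j : (i <= j)%N -> u i <= u j.
  move=> /subnK <-; elim: (j - i)%N => // m IH.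
  by rewrite addSn; exact: le_trans IH (u1 _).
have decr i j : (i <= j)%N -> u j + H / 2 ^+ j <= u i + H / 2 ^+ i.
  move=> /subnK <-; elim: (j - i)%N => // m IH.
  by rewrite addSn; exact: le_trans (u2 _) IH.
have ub k : ubound (range u) (u k + H / 2 ^+ k).
  move=> _ [j _ <-]; have [jk|/ltnW kj] := leqP j k.
    by rewrite (le_trans (incr _ _ jk))// lerDl divr_ge0// exprn_ge0.
  by rewrite (le_trans _ (decr _ _ kj))// lerDl divr_ge0// exprn_ge0.
exists (sup (range u)) => k; apply/andP; split.
  by apply: ub_le_sup; [exists (u 0%N + H / 2 ^+ 0); exact: ub|exists k].
by apply: ge_sup; [exists (u 0%N), 0%N|exact: ub].
Qed.

(** Frechet differentiability at [(s0, t0)] with gradient [(p, q)], for a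
    curried [f] so that [f s] and [f ^~ t] are its restrictions to lines. *)
Definition first_order (f : R -> R -> R) (p q s0 t0 : R) : Prop :=
  forall e, 0 < e -> exists2 d, 0 < d & forall s t,
    `|s - s0| < d -> `|t - t0| < d ->
    `|f s t - f s0 t0 - p * (s - s0) - q * (t - t0)| <=
      e * (`|s - s0| + `|t - t0|).

Variables (S1 S2 T1 T2 : R) (S12 : S1 <= S2) (T12 : T1 <= T2).
Variables (a b P Q : R -> R -> R).
Hypothesis dP : forall s t, S1 <= s <= S2 -> T1 <= t <= T2 ->
  is_derive t 1 (P s) (a s t).
Hypothesis dQ : forall s t, S1 <= s <= S2 -> T1 <= t <= T2 ->
  is_derive s 1 (Q ^~ t) (b s t).
Hypothesis closed_form : forall s t, S1 <= s <= S2 -> T1 <= t <= T2 ->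
  exists p q r, first_order a p q s t /\ first_order b r p s t.

(** The integral of the form [b ds + a dt] along the boundary of the rectangle
    with lower corner [(s, t)] and sides [h], [k].  It is written with
    primitives of [a] in [t] and of [b] in [s], so that additivity under
    subdivision is an algebraic identity. *)
Definition circulation s h t k :=
  (P (s + h) (t + k) - P (s + h) t - P s (t + k) + P s t) -
  (Q (s + h) (t + k) - Q s (t + k) - Q (s + h) t + Q s t).

Lemma circulation_bisect s h t k :
  circulation s (h + h) t (k + k) =
  circulation s h t k + circulation (s + h) h t k + circulation s h (t + k) k
  + circulation (s + h) h (t + k) k.
Proof. by rewrite /circulation !addrA; ring. Qed.

Lemma increment_bound (f df : R -> R) (x y c : R) : x <= y ->
  (forall z : R, x <= z <= y -> is_derive z 1 f (df z)) ->
  (forall z, x <= z <= y -> `|df z| <= c) ->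
  `|f y - f x| <= c * (y - x).
Proof.
move=> xy dfE dfc.
have dfo z : z \in `]x, y[%R -> is_derive z 1 f (df z).
  by move=> /[!in_itv]/= /andP[/ltW xz /ltW zy]; apply: dfE; rewrite xz.
have cf : {within `[x, y], continuous f}.
  apply: derivable_within_continuous => z /[!in_itv]/= zxy.
  by have := dfE z zxy; case.
have [z /[!in_itv]/= zxy ->] := MVT_segment xy dfo cf.
by rewrite normrM [X in _ * X]ger0_norm ?subr_ge0// ler_wpM2r ?subr_ge0// dfc.
Qed.

(** The affine parts of [a] and [b] contribute [p * h * k] to the [P] and to
    the [Q] increments alike, which cancels because [a_s = b_t = p]; the
    mean value inequality bounds what is left. *)
Lemma circulation_small s0 t0 : S1 <= s0 <= S2 -> T1 <= t0 <= T2 ->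
  forall e, 0 < e -> exists2 d, 0 < d & forall s h t k,
    0 <= h < d -> 0 <= k < d ->
    S1 <= s -> s <= s0 <= s + h -> s + h <= S2 ->
    T1 <= t -> t <= t0 <= t + k -> t + k <= T2 ->
    `|circulation s h t k| <= e * (h + k) ^+ 2.
Proof.
move=> hs0 ht0 e e0.
have [p [q [r [ja jb]]]] := closed_form hs0 ht0.
have e20 : 0 < e / 2 by rewrite divr_gt0.
have [d1 d10 {}ja] := ja _ e20.
have [d2 d20 {}jb] := jb _ e20.
exists (Num.min d1 d2); first by rewrite lt_min d10.
move=> s h t k /andP[h0 +] /andP[k0 +]; rewrite !lt_min.
move=> /andP[hd1 hd2] /andP[kd1 kd2] s1 /andP[s2 s3] s4 t1 /andP[t2 t3] t4.
have near x y z w (d : R) : 0 <= z -> z < d ->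
    x <= y <= x + z -> x <= w <= x + z ->
    `|w - y| < d /\ `|w - y| <= z.
  move=> z0 zd /andP[xy yz] /andP[xw wz].
  suff : `|w - y| <= z by split => //; exact: le_lt_trans zd.
  by rewrite ler_norml; apply/andP; split; lra.
have aE w x : s <= w <= s + h -> t <= x <= t + k ->
    `|a w x - a s0 t0 - p * (w - s0) - q * (x - t0)| <= e / 2 * (h + k).
  move=> hw hx.
  have [w1 w2] := near s s0 h w d1 h0 hd1 ltac:(by rewrite s2) hw.
  have [x1 x2] := near t t0 k x d1 k0 kd1 ltac:(by rewrite t2) hx.
  by apply: le_trans (ja _ _ w1 x1) _; rewrite ler_pM2l// lerD.
have bE w x : s <= w <= s + h -> t <= x <= t + k ->
    `|b w x - b s0 t0 - r * (w - s0) - p * (x - t0)| <= e / 2 * (h + k).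
  move=> hw hx.
  have [w1 w2] := near s s0 h w d2 h0 hd2 ltac:(by rewrite s2) hw.
  have [x1 x2] := near t t0 k x d2 k0 kd2 ltac:(by rewrite t2) hx.
  by apply: le_trans (jb _ _ w1 x1) _; rewrite ler_pM2l// lerD.
have sh : s <= s + h by rewrite lerDl.
have tk : t <= t + k by rewrite lerDl.
have incrP : `|(P (s + h) (t + k) - P s (t + k) - p * h * (t + k)) -
    (P (s + h) t - P s t - p * h * t)| <= e * (h + k) * (t + k - t).
  apply: (@increment_bound (fun x => P (s + h) x - P s x - p * h * x)
     (fun x => a (s + h) x - a s x - p * h)) => // x /andP[x1 x2].
    have xT : T1 <= x <= T2 by apply/andP; split; lra.
    have d1P : is_derive x 1 (P (s + h)) (a (s + h) x).
      by apply: dP => //; apply/andP; split; lra.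
    have d2P : is_derive x 1 (P s) (a s x).
      by apply: dP => //; apply/andP; split; lra.
    apply: is_derive_eq; by rewrite !scaler1 /=.
  have := aE (s + h) x ltac:(by rewrite sh lexx) ltac:(by rewrite x1).
  have := aE s x ltac:(by rewrite sh lexx) ltac:(by rewrite x1).
  rewrite !ler_norml => /andP[? ?] /andP[? ?].
  by apply/andP; split; lra.
have incrQ : `|(Q (s + h) (t + k) - Q (s + h) t - p * k * (s + h)) -
    (Q s (t + k) - Q s t - p * k * s)| <= e * (h + k) * (s + h - s).
  apply: (@increment_bound (fun x => Q x (t + k) - Q x t - p * k * x)
     (fun x => b x (t + k) - b x t - p * k)) => // x /andP[x1 x2].
    have xT : S1 <= x <= S2 by apply/andP; split; lra.
    have d1P : is_derive x 1 (Q ^~ (t + k)) (b x (t + k)).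
      by apply: dQ => //; apply/andP; split; lra.
    have d2P : is_derive x 1 (Q ^~ t) (b x t).
      by apply: dQ => //; apply/andP; split; lra.
    apply: is_derive_eq; by rewrite !scaler1 /=.
  have := bE x (t + k) ltac:(by rewrite x1) ltac:(by rewrite tk lexx).
  have := bE x t ltac:(by rewrite x1) ltac:(by rewrite tk lexx).
  rewrite !ler_norml => /andP[? ?] /andP[? ?].
  by apply/andP; split; lra.
move: incrP incrQ; rewrite !ler_norml /circulation => /andP[? ?] /andP[? ?].
by apply/andP; split; nra.
Qed.

(** The lower corner of the [k]-th rectangle of Goursat's bisection, which
    keeps one quarter whose circulation is at least a fourth of the current
    one. *)
Fixpoint corner k : R * R :=
  if k is k'.+1 then
    let h := (S2 - S1) / 2 ^+ k in let l := (T2 - T1) / 2 ^+ k in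
    let c := corner k' in
    let next (e : bool * bool) :=
      (c.1 + (if e.1 then h else 0), c.2 + (if e.2 then l else 0)) in
    if [pick e | `|circulation c.1 (h + h) c.2 (l + l)| <=
                 4 * `|circulation (next e).1 h (next e).2 l| ] is Some e
    then next e else c
  else (S1, T1).

Lemma half2 (x : R) k : x / 2 ^+ k.+1 + x / 2 ^+ k.+1 = x / 2 ^+ k.
Proof. by rewrite exprS; field. Qed.

(** A suitable quarter exists: otherwise the four circulations could not add
    up to that of the whole rectangle. *)
Lemma corner_step k :
  let c := corner k in let c' := corner k.+1 in
  let h := (S2 - S1) / 2 ^+ k.+1 in let l := (T2 - T1) / 2 ^+ k.+1 in
  [/\ c.1 <= c'.1, c'.1 + h <= c.1 + (S2 - S1) / 2 ^+ k,
      c.2 <= c'.2, c'.2 + l <= c.2 + (T2 - T1) / 2 ^+ k &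
      `|circulation c.1 ((S2 - S1) / 2 ^+ k) c.2 ((T2 - T1) / 2 ^+ k)| <=
      4 * `|circulation c'.1 h c'.2 l|].
Proof.
rewrite -(half2 (S2 - S1) k) -(half2 (T2 - T1) k) [corner k.+1]/=.
set c := corner k.
set h := (S2 - S1) / _; set l := (T2 - T1) / _.
have h0 : 0 <= h by rewrite divr_ge0 ?subr_ge0// exprn_ge0.
have l0 : 0 <= l by rewrite divr_ge0 ?subr_ge0// exprn_ge0.
case: pickP => [[e1 e2]/= H|H].
  by split => //; case: e1 e2 H => [] []; lra.
exfalso; have := H (true, true); have := H (true, false).
have := H (false, true); have := H (false, false); rewrite /= !addr0.
move=> /negbT + /negbT + /negbT + /negbT; rewrite -!ltNge.
rewrite circulation_bisect => H1 H2 H3 H4.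
have := ler_normD (circulation c.1 h c.2 l + circulation (c.1 + h) h c.2 l
  + circulation c.1 h (c.2 + l) l) (circulation (c.1 + h) h (c.2 + l) l).
have := ler_normD (circulation c.1 h c.2 l + circulation (c.1 + h) h c.2 l)
  (circulation c.1 h (c.2 + l) l).
have := ler_normD (circulation c.1 h c.2 l) (circulation (c.1 + h) h c.2 l).
lra.
Qed.

(** The [k]-th rectangle of the bisection carries at least [4 ^- k] times the
    total circulation, whereas by [circulation_small] at the common point of
    the rectangles it carries at most [e * 4 ^- k] times a constant, for every
    [e > 0]. *)
Lemma green_rectangle :
  P S2 T2 - P S2 T1 - P S1 T2 + P S1 T1 = Q S2 T2 - Q S1 T2 - Q S2 T1 + Q S1 T1.
Proof.
set H := S2 - S1; set K := T2 - T1.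
have H0 : 0 <= H by rewrite subr_ge0.
have K0 : 0 <= K by rewrite subr_ge0.
have [s0 hs0] := @nested_intervals (fun k => (corner k).1) H
  (fun k => let: And5 h _ _ _ _ := corner_step k in h)
  (fun k => let: And5 _ h _ _ _ := corner_step k in h) H0.
have [t0 ht0] := @nested_intervals (fun k => (corner k).2) K
  (fun k => let: And5 _ _ h _ _ := corner_step k in h)
  (fun k => let: And5 _ _ _ h _ := corner_step k in h) K0.
have inS k : S1 <= (corner k).1 /\ (corner k).1 + H / 2 ^+ k <= S2.
  elim: k => [|k [IH1 IH2]]; first by rewrite /= expr0 divr1 /H; split; lra.
  have [h1 h2 _ _ _] := corner_step k; split; first exact: le_trans h1.
  exact: le_trans h2 IH2.
have inT k : T1 <= (corner k).2 /\ (corner k).2 + K / 2 ^+ k <= T2.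
  elim: k => [|k [IH1 IH2]]; first by rewrite /= expr0 divr1 /K; split; lra.
  have [_ _ h1 h2 _] := corner_step k; split; first exact: le_trans h1.
  exact: le_trans h2 IH2.
have big k : `|circulation S1 H T1 K| <=
    4 ^+ k * `|circulation (corner k).1 (H / 2 ^+ k) (corner k).2 (K / 2 ^+ k)|.
  elim: k => [|k IH]; first by rewrite /= !expr0 !divr1 mul1r.
  have [_ _ _ _ h] := corner_step k.
  by rewrite (le_trans IH)// exprSr -mulrA ler_pM2l ?exprn_gt0.
suff: circulation S1 H T1 K = 0.
  rewrite /circulation /H /K ![_ + (_ - _)]addrC !subrK => /eqP.
  by rewrite subr_eq0 => /eqP.
apply/eqP; rewrite -normr_le0; apply/ler_addgt0Pr => e e0; rewrite add0r.
pose e' := e / ((H + K) ^+ 2 + 1).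
have HK : 0 < (H + K) ^+ 2 + 1 by rewrite ltr_wpDl// sqr_ge0.
have e'0 : 0 < e' by rewrite divr_gt0.
have hs0' : S1 <= s0 <= S2 by have := hs0 0%N; rewrite /= expr0 divr1 /H; lra.
have ht0' : T1 <= t0 <= T2 by have := ht0 0%N; rewrite /= expr0 divr1 /K; lra.
have [d d0 hd] := circulation_small hs0' ht0' e'0.
have [k hk] : exists k, H / 2 ^+ k < d /\ K / 2 ^+ k < d.
  have small x : exists k0, forall k, (k0 <= k)%N -> x / 2 ^+ k < d.
    have := @cvg_geometric R x 2^-1 ltac:(by rewrite ger0_norm; lra).
    move/cvgrPdist_lt => /(_ d d0) [k0 _ hk0]; exists k0 => k kk.
    have := hk0 k kk; rewrite /= sub0r normrN /geometric/= exprVn.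
    exact: le_lt_trans (ler_norm _).
  have [k1 h1] := small H; have [k2 h2] := small K.
  exists (maxn k1 k2); split; [exact/h1/leq_maxl|exact/h2/leq_maxr].
have := hd (corner k).1 (H / 2 ^+ k) (corner k).2 (K / 2 ^+ k).
move=> /(_ _ _ (inS k).1 (hs0 k) (inS k).2 (inT k).1 (ht0 k) (inT k).2).
rewrite !divr_ge0 ?exprn_ge0//= => /(_ hk.1 hk.2) small.
rewrite (le_trans (big k))//.
rewrite (le_trans (ler_wpM2l _ small)) ?exprn_ge0//.
rewrite -mulrDl exprMn mulrCA [X in _ * X]mulrCA exprVn -exprM mulnC exprM.
rewrite (_ : 2 ^+ 2 = 4 :> R); last by ring.
rewrite divff ?expf_neq0// mulr1 /e' mulrAC ler_pdivrMr// ler_pM2l//; lra.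
Qed.

End goursat.

(** * The mean value property on circles *)

Section antiderivative.
Variable R : realType.
Local Notation mu := (@lebesgue_measure R).

(** The primitive is the integral from [A], whence the restriction to points
    to the right of [A]. *)
Lemma antiderivative (f : R -> R) (A : R) : continuous f ->
  exists F : R -> R, (forall x, A < x -> is_derive x 1 F (f x)) /\
    forall x y, A < x <= y -> \int[mu]_(t in `[x, y]) f t = F y - F x.
Proof.
move=> cf.
have intf x y : mu.-integrable `[x, y] (EFin \o f).
  apply: continuous_compact_integrable; first exact: segment_compact.
  exact: continuous_subspaceT.
exists (fun x => \int[mu]_(t in `[A, x]) f t); split.
  move=> x Ax; have xx : x < x + 1 by rewrite ltrDl.
  have [dF FE] := continuous_FTC1_closed xx (intf _ _) Ax (cf x).
  by rewrite -FE derive1E; apply: DeriveDef.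
move=> x y /andP[Ax xy]; rewrite Rintegral_itvB// ?bnd_simp ?(ltW Ax)//.
rewrite Rintegral_itv_obnd_cbnd//; apply: integrableS (intf x y) => //.
exact: subset_itv_oc_cc.
Qed.

End antiderivative.

Section complex_differentiability.
Variable R : realType.
Local Notation C := R[i].
Local Notation normc := ComplexField.Normc.normc.
Local Notation mu := (@lebesgue_measure R).
Local Notation Re := complex.Re.
Local Notation Im := complex.Im.

Lemma normr_normc (z : C) : `|z| = (normc z)%:C.
Proof. by []. Qed.

Lemma normc_ge0 (z : C) : 0 <= normc z.
Proof. by case: z => a b; exact: sqrtr_ge0. Qed.

Lemma normr_Re_le (z : C) : `|Re z| <= normc z.
Proof.
case: z => a b /=; rewrite -sqrtr_sqr ler_sqrt ?lerDl ?sqr_ge0//.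
by rewrite addr_ge0// sqr_ge0.
Qed.

Lemma normr_Im_le (z : C) : `|Im z| <= normc z.
Proof.
case: z => a b /=; rewrite -sqrtr_sqr ler_sqrt ?lerDr ?sqr_ge0//.
by rewrite addr_ge0// sqr_ge0.
Qed.

Lemma normc_le_ReIm (z : C) : normc z <= `|Re z| + `|Im z|.
Proof.
case: z => a b /=; rewrite -[leRHS]ger0_norm ?addr_ge0// -sqrtr_sqr.
rewrite ler_sqrt ?sqr_ge0// sqrrD !real_normK ?num_real//.
by have := mulr_ge0 (normr_ge0 a) (normr_ge0 b); lra.
Qed.

Lemma differentiable_expansion (g : C -> C) (z : C^o) :
  differentiable (g : C^o -> C^o) z ->
  exists D : C, forall e : R, 0 < e -> exists2 d : R, 0 < d & forall w,
    normc (w - z) < d ->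
    normc (g w - g z - D * (w - z)) <= e * normc (w - z).
Proof.
move=> dg; exists ('d (g : C^o -> C^o) z 1) => e e0.
have /eqaddoP/(_ e%:C) := diff_locally dg.
rewrite ltcR => /(_ e0) /nbhs_ballP[d /=].
rewrite ltcE/= => /andP[/eqP d1 d0] hd.
have dE : d = (Re d)%:C by case: d d1 {d0 hd} => a b /= ->.
exists (Re d) => // w wz; have := hd (w - z).
rewrite -ball_normE /ball_ /= sub0r normrN dE !normr_normc ltcR => /(_ wz).
rewrite /cst /shift !fctE /= subrK lecE/= => /andP[_].
have -> : 'd (g : C^o -> C^o) z (w - z) = 'd (g : C^o -> C^o) z 1 * (w - z).
  rewrite -[X in 'd _ _ X]mulr1 -[_ * 1]/((w - z) *: (1 : C^o)).
  by rewrite linearZ/= mulrC.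
rewrite mul0r subr0 opprD addrA; exact.
Qed.

Section strip.
Variable h : C -> C.
Hypothesis dh : forall z : C^o, differentiable (h : C^o -> C^o) z.

(** If [p + i r] is the complex derivative, the real part has gradient
    [(p, - r)] and the imaginary part [(r, p)]; the shared [p] is the closedness
    condition of [green_rectangle]. *)
Lemma cauchy_riemann s t : exists p q r : R,
  first_order (fun s t => Re (h (s +i* t))) p q s t /\
  first_order (fun s t => Im (h (s +i* t))) r p s t.
Proof.
have [[p r] hD] := differentiable_expansion (dh (s +i* t)).
have key e : 0 < e -> exists2 d, 0 < d & forall s' t',
    `|s' - s| < d -> `|t' - t| < d ->
    normc (h (s' +i* t') - h (s +i* t) - (p +i* r) * ((s' - s) +i* (t' - t)))
      <= e * (`|s' - s| + `|t' - t|).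
  move=> e0; have [d d0 hd] := hD _ e0.
  exists (d / 2); first by rewrite divr_gt0.
  move=> s' t' hs ht.
  have st := normc_le_ReIm ((s' - s) +i* (t' - t)).
  apply: le_trans (hd (s' +i* t') _) _.
    by apply: le_lt_trans st _; rewrite /=; lra.
  by rewrite ler_pM2l.
exists p, (- r), r; split => e e0; have [d d0 hd] := key _ e0;
  exists d => // s' t' hs ht; apply: le_trans (hd s' t' hs ht).
- apply: le_trans (normr_Re_le _); rewrite le_eqVlt; apply/orP/or_introl/eqP.
  congr (`|_|); move: (h _) (h _) => [? ?] [? ?] /=; ring.
- apply: le_trans (normr_Im_le _); rewrite le_eqVlt; apply/orP/or_introl/eqP.
  congr (`|_|); move: (h _) (h _) => [? ?] [? ?] /=; ring.
Qed.

Lemma near_dist (x d : R) : 0 < d -> \forall y \near x, `|y - x| < d.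
Proof.
by move=> d0; apply: filterS (nbhsx_ballx x _ d0) => y; rewrite /ball /= distrC.
Qed.

Lemma first_order_continuous (f : R -> R -> R) p q s t :
  first_order f p q s t -> {for t, continuous (f s)}.
Proof.
move=> hf; have [d d0 hd] := hf 1 ltr01.
apply/cvgrPdist_lt => e e0.
have q0 : 0 < 1 + `|q| by rewrite ltr_wpDr.
near=> t'; rewrite distrC.
have tt : `|t' - t| < d by near: t'; exact: near_dist.
have te : `|t' - t| < e / (1 + `|q|).
  by near: t'; apply: near_dist; rewrite divr_gt0.
have := hd s t'; rewrite !subrr !normr0 mulr0 subr0 add0r mul1r.
move=> /(_ d0 tt) h1.
apply: (@le_lt_trans _ _ (`|t' - t| + `|q * (t' - t)|)).
  by rewrite -lerBlDr; apply: le_trans h1; exact: lerB_dist.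
by move: te; rewrite ltr_pdivlMr// normrM mulrDr mulr1 [_ * `|q|]mulrC.
Unshelve. all: by end_near. Qed.

Lemma first_order_swap (f : R -> R -> R) p q s t :
  first_order f p q s t -> first_order (fun x y => f y x) q p t s.
Proof.
move=> hf e e0; have [d d0 hd] := hf e e0; exists d => // x y xt ys.
by rewrite [`|x - t| + _]addrC -[_ - q * _ - _]addrAC; exact: hd.
Qed.

(** Two opposite sides of the rectangle contribute the same integral by
    periodicity, so the other two agree as well. *)
Lemma periodic_mean_const (T S1 S2 : R) : 0 <= T -> S1 <= S2 ->
  (forall s, h (s +i* T) = h (s +i* 0)) ->
  \int[mu]_(t in `[0, T]) Re (h (S1 +i* t)) =
  \int[mu]_(t in `[0, T]) Re (h (S2 +i* t)).
Proof.
move=> T0 S12 hT.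
pose a s t := Re (h (s +i* t)); pose b s t := Im (h (s +i* t)).
have ca s : continuous (a s).
  by move=> t; have [p [q [r [/first_order_continuous]]]] := cauchy_riemann s t.
have cb t : continuous (b ^~ t).
  move=> s; have [p [q [r [_ /first_order_swap]]]] := cauchy_riemann s t.
  exact: first_order_continuous.
have [P hP] := choice (fun s => antiderivative (- 1) (ca s)).
have [Q hQ] := choice (fun t => antiderivative (S1 - 1) (cb t)).
have QE : Q T S2 - Q T S1 = Q 0 S2 - Q 0 S1.
  rewrite -(hQ T).2; last by apply/andP; split; lra.
  rewrite -(hQ 0).2; last by apply/andP; split; lra.
  by apply: eq_Rintegral => s _; rewrite /b hT.
have dP s t : S1 <= s <= S2 -> 0 <= t <= T -> is_derive t 1 (P s) (a s t).
  by move=> _ /andP[t0 _]; apply: (hP s).1; lra.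
have dQ s t : S1 <= s <= S2 -> 0 <= t <= T -> is_derive s 1 (Q t) (b s t).
  by move=> /andP[s0 _] _; apply: (hQ t).1; lra.
have := green_rectangle S12 T0 dP dQ (fun s t _ _ => cauchy_riemann s t).
rewrite (hP S1).2 ?(hP S2).2; last 2 first.
- by apply/andP; split; lra.
- by apply/andP; split; lra.
by move=> H; lra.
Qed.

End strip.

End complex_differentiability.

Section circle.
Variable R : realType.
Local Notation C := R[i].
Local Notation normc := ComplexField.Normc.normc.
Local Notation mu := (@lebesgue_measure R).
Local Notation Re := complex.Re.
Local Notation Im := complex.Im.

Lemma derive_expansion (f : R -> R) (x l : R) : is_derive x 1 f l ->
  forall e, 0 < e -> exists2 d, 0 < d & forall y,
    `|y - x| < d -> `|f y - f x - l * (y - x)| <= e * `|y - x|.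
Proof.
move=> [/derivable1_diffP df fl] e e0.
have /eqaddoP/(_ e e0) /nbhs_ballP[d /= d0 hd] := diff_locally df.
exists d => // y yx; have := hd (y - x).
rewrite -ball_normE /ball_ /= sub0r normrN => /(_ yx).
rewrite /cst /shift !fctE /= subrK.
have -> : 'd f x (y - x) = l * (y - x).
  rewrite -fl deriveE// -[X in 'd _ _ X]mulr1.
  by rewrite -[_ * 1]/((y - x) *: (1 : R)) linearZ/= mulrC.
by rewrite opprD addrA; exact.
Qed.

Lemma expansion_differentiable (g : C -> C) (z : C^o) (D : C) :
  (forall e : R, 0 < e -> exists2 d : R, 0 < d & forall w : C,
    normc (w - z) < d ->
    normc (g w - g z - D * (w - z)) <= e * normc (w - z)) ->
  differentiable (g : C^o -> C^o) z.
Proof.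
move=> hg; apply/derivable1_diffP/cvg_ex; exists D.
apply/cvgrPdist_le => /= e; rewrite ltcE/= => /andP[/eqP e1 e0].
have eE : e = (Re e)%:C by case: e e1 {e0} => a b /= ->.
have [d d0 hd] := hg _ e0; near=> k.
have k0 : k != 0 by near: k; exact: (@nbhs_dnbhs_neq C^o 0).
have kd : normc k < d.
  near: k; apply: nbhs_dnbhs; apply/nbhs_ballP; exists d%:C => /=.
    by rewrite ltcR.
  by move=> y /=; rewrite -ball_normE /ball_/= sub0r normrN normr_normc ltcR.
have := hd (k + z); rewrite addrK => /(_ kd).
rewrite eE -lecR -normr_normc rmorphM/= -normr_normc => h.
rewrite distrC -[_ *: 1]/(k * 1) mulr1.
rewrite -[_ *: _]/(k^-1 * (g (k + z) - g z)).
rewrite -(@ler_pM2r _ `|k|) ?normr_gt0// -normrM mulrBl.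
by rewrite mulrAC mulVf// mul1r.
Unshelve. all: by end_near. Qed.

Lemma cexpD (z w : C) : cexp (z + w) = cexp z * cexp w.
Proof.
case: z w => a b [c d]; rewrite /cexp/= expRD cosD sinD; simpc.
by congr (_ +i* _); ring.
Qed.

Lemma cexp_expansion0 (e : R) : 0 < e -> exists2 d : R, 0 < d & forall w : C,
  normc w < d -> normc (cexp w - 1 - w) <= e * normc w.
Proof.
(* the first-order errors of exp, cos and sin add up to at most 6 e' |w| *)
move=> e0; pose e' := Num.min 1 (e / 10).
have e'0 : 0 < e' by rewrite lt_min ltr01 divr_gt0.
have e'1 : e' <= 1 by rewrite ge_min lexx.
have e'e : e' <= e / 10 by rewrite ge_min lexx orbT.
have [d1 d10 h1] := derive_expansion (is_derive_expR 0) e'0.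
have [d2 d20 h2] := derive_expansion (is_derive_cos 0) e'0.
have [d3 d30 h3] := derive_expansion (is_derive_sin 0) e'0.
exists (Num.min (Num.min d1 d2) (Num.min d3 (e' / 2))).
  by rewrite !lt_min d10 d20 d30 divr_gt0.
move=> [a b]; rewrite !lt_min => /andP[/andP[wd1 wd2] /andP[wd3 wd4]].
have an := normr_Re_le (a +i* b); have bn := normr_Im_le (a +i* b).
move: an bn wd1 wd2 wd3 wd4; set N := normc (a +i* b) => an bn wd1 wd2 wd3 wd4.
rewrite [complex.Re _]/= in an; rewrite [complex.Im _]/= in bn.
have := h1 a; have := h2 b; have := h3 b.
rewrite expR0 cos0 sin0 !oppr0 !addr0 !mul1r !mul0r ?oppr0 ?addr0.
move=> /(_ (le_lt_trans bn wd3)) s1 /(_ (le_lt_trans bn wd2)) c1.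
move=> /(_ (le_lt_trans an wd1)) e1.
apply: le_trans (normc_le_ReIm _) _.
have a0 := normr_ge0 a; have b0 := normr_ge0 b.
have e'a : e' * `|a| <= 1 * `|a| by rewrite ler_wpM2r.
have e'b : e' * `|b| <= 1 * `|b| by rewrite ler_wpM2r.
have ea1 : `|expR a - 1| <= 2 * `|a|.
  have -> : expR a - 1 = (expR a - 1 - a) + a by ring.
  by apply: le_trans (ler_normD _ _) _; lra.
have sb : `|sin b| <= 2 * `|b|.
  have -> : sin b = (sin b - b) + b by ring.
  by apply: le_trans (ler_normD _ _) _; lra.
have ea2 : expR a <= 2.
  have := ler_norm (expR a - 1); lra.
have -> : Re (cexp (a +i* b) - 1 - (a +i* b)) =
    (expR a - 1 - a) + expR a * (cos b - 1).
  by rewrite /cexp/=; ring.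
have -> : Im (cexp (a +i* b) - 1 - (a +i* b)) =
    (expR a - 1) * sin b + (sin b - b).
  by rewrite /cexp/=; ring.
have r1 := ler_normD (expR a - 1 - a) (expR a * (cos b - 1)).
have r2 := ler_normD ((expR a - 1) * sin b) (sin b - b).
move: r1 r2; rewrite !normrM (ger0_norm (expR_ge0 a)) => r1 r2.
have r3 : expR a * `|cos b - 1| <= 2 * (e' * `|b|).
  by rewrite ler_pM// expR_ge0.
have r4 : `|expR a - 1| * `|sin b| <= e' * (2 * `|b|).
  by rewrite ler_pM//; lra.
nra.
Qed.

Lemma normcM (z w : C) : normc (z * w) = normc z * normc w.
Proof. exact: ComplexField.Normc.normcM. Qed.

Lemma ler_normcD (z w : C) : normc (z + w) <= normc z + normc w.
Proof. by rewrite -lecR rmorphD/= -!normr_normc ler_normD. Qed.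

Lemma differentiable_cexp (z : C^o) : differentiable (@cexp R : C^o -> C^o) z.
Proof.
apply: (@expansion_differentiable _ _ (cexp z)) => e e0.
have nz : 0 < normc (cexp z) + 1 by rewrite ltr_wpDl// normc_ge0.
have [|d d0 hd] := @cexp_expansion0 (e / (normc (cexp z) + 1)).
  by rewrite divr_gt0.
exists d => // w /hd; set k := w - z => hk.
have -> : w = z + k by rewrite addrC subrK.
rewrite cexpD.
have -> : cexp z * cexp k - cexp z - cexp z * k = cexp z * (cexp k - 1 - k).
  by ring.
rewrite normcM (le_trans (ler_wpM2l (normc_ge0 _) hk))// mulrA.
rewrite ler_wpM2r ?normc_ge0//.
by rewrite mulrCA ger_pMr// ler_pdivrMr// mul1r lerDl.
Qed.

Lemma differentiable_comp_cexp (g : C -> C) :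
  (forall z : C^o, differentiable (g : C^o -> C^o) z) ->
  forall z : C^o, differentiable ((g \o @cexp R) : C^o -> C^o) z.
Proof.
move=> dg z; exact: (@differentiable_comp _ _ _ _ (@cexp R : C^o -> C^o)
  (g : C^o -> C^o) z (differentiable_cexp z) (dg (cexp z))).
Qed.

Lemma normc_cexp (z : C) : normc (cexp z) = expR (Re z).
Proof.
rewrite /cexp normcM/= expr0n addr0 sqrtr_sqr ger0_norm ?expR_ge0//.
by rewrite cos2Dsin2 sqrtr1 mulr1.
Qed.

(** The mean over the circle of radius [e^s] does not depend on [s], by
    [periodic_mean_const] for [g \o cexp], and it tends to the value at the
    centre when the radius tends to 0. *)
Lemma circle_mean (g : C -> C) :
  (forall z : C^o, differentiable (g : C^o -> C^o) z) ->
  \int[mu]_(t in `[0, 2 * pi]) Re (g (cos t +i* sin t)) = 2 * pi * Re (g 0).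
Proof.
move=> dg; pose h := g \o @cexp R.
have dh := differentiable_comp_cexp dg.
have pi20 : 0 <= 2 * pi :> R by rewrite mulr_ge0// pi_ge0.
have hper s : h (s +i* (2 * pi)) = h (s +i* 0).
  by rewrite /h /cexp/= mulr_natl cos2pi sin2pi cos0 sin0.
have -> : \int[mu]_(t in `[0, 2 * pi]) Re (g (cos t +i* sin t)) =
    \int[mu]_(t in `[0, 2 * pi]) Re (h (0 +i* t)).
  by apply: eq_Rintegral => t _; rewrite /h /cexp/= expR0 mul1r.
have ch s : continuous (fun t => Re (h (s +i* t))).
  move=> t; have [p [q [r [H _]]]] := cauchy_riemann dh s t.
  exact: first_order_continuous H.
have ih s : mu.-integrable `[0, 2 * pi] (EFin \o (fun t => Re (h (s +i* t)))).
  apply: continuous_compact_integrable; first exact: segment_compact.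
  exact: continuous_subspaceT.
have ic (c : R) : mu.-integrable `[0, 2 * pi] (EFin \o cst c).
  apply: continuous_compact_integrable; first exact: segment_compact.
  by apply: continuous_subspaceT => x; exact: cvg_cst.
have fpi : fine (mu `[0, 2 * pi]%classic) = 2 * pi.
  rewrite lebesgue_measure_itv/= lte_fin.
  by case: ltP => /= h0; rewrite ?subr0//; lra.
apply/eqP; rewrite -subr_eq0 -normr_le0.
apply/ler_addgt0Pr => e e0; rewrite add0r.
have [D /(_ 1 ltr01)[d d0 hd]] := differentiable_expansion (dg 0).
pose K := normc D + 1.
have K0 : 0 < K by rewrite ltr_wpDl// normc_ge0.
pose e' := e / (2 * pi + 1).
have e'0 : 0 < e' by rewrite divr_gt0// ltr_wpDl.
(* r < d makes the expansion of g at 0 valid on the circle of radius r, r <= 1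
   puts that circle inside the unit one, and r <= e' / K makes g vary by at
   most r + |D| r <= e' there *)
pose r := Num.min (Num.min d 1) (e' / K) / 2.
have r0 : 0 < r by rewrite divr_gt0// !lt_min d0 ltr01 divr_gt0.
have [rd r1 re] : [/\ r < d, r <= 1 & r <= e' / K].
  rewrite /r; set x := Num.min _ _.
  have x1 : x <= d by rewrite !ge_min lexx.
  have x2 : x <= 1 by rewrite !ge_min lexx orbT.
  have x3 : x <= e' / K by rewrite !ge_min lexx !orbT.
  have x0 : 0 < x by rewrite !lt_min d0 ltr01 divr_gt0.
  by split; lra.
have near t : `|Re (h (ln r +i* t)) - Re (g 0)| <= e'.
  have nr : normc (cexp (ln r +i* t)) = r by rewrite normc_cexp/= lnK.
  have := hd (cexp (ln r +i* t)); rewrite subr0 nr mul1r => /(_ rd) hz.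
  have -> : Re (h (ln r +i* t)) - Re (g 0) = Re (h (ln r +i* t) - g 0).
    by case: (h _) (g 0) => [? ?] [? ?].
  rewrite (le_trans (normr_Re_le _))//.
  rewrite -(subrK (D * cexp (ln r +i* t)) (h (ln r +i* t) - g 0)).
  rewrite (le_trans (ler_normcD _ _))// normcM nr.
  apply: le_trans (lerD hz (lexx _)) _.
  by move: re; rewrite ler_pdivlMr// /K; lra.
have <- : \int[mu]_(t in `[0, 2 * pi]) Re (h (ln r +i* t)) =
    \int[mu]_(t in `[0, 2 * pi]) Re (h (0 +i* t)).
  by apply: periodic_mean_const => //; rewrite ln_le0.
have -> : 2 * pi * Re (g 0) = \int[mu]_(t in `[0, 2 * pi]) cst (Re (g 0)) t.
  by rewrite Rintegral_cst// fpi mulrC.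
rewrite -RintegralB//.
have ihg : mu.-integrable `[0, 2 * pi]
    (EFin \o (fun t => Re (h (ln r +i* t)) - cst (Re (g 0)) t)).
  exact: (integrableB _ (ih (ln r)) (ic (Re (g 0)))).
apply: le_trans (le_normr_Rintegral _ ihg) _ => //.
apply: (@le_trans _ _ (\int[mu]_(t in `[0, 2 * pi]) cst e' t)).
  by apply: le_Rintegral => //; exact: (integrable_abse ihg).
rewrite Rintegral_cst// fpi /e' mulrAC ler_pdivrMr ?ltr_wpDl//.
by rewrite ler_pM2l//; lra.
Qed.

Lemma integrable_circle (g : C -> C) :
  (forall z : C^o, differentiable (g : C^o -> C^o) z) ->
  mu.-integrable `[0, 2 * pi]
    (EFin \o (fun t => Re (g (cos t +i* sin t)))).
Proof.
move=> dg; apply: continuous_compact_integrable; first exact: segment_compact.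
apply: continuous_subspaceT => t.
pose h := g \o @cexp R.
have dh := differentiable_comp_cexp dg.
have [p [q [r [/first_order_continuous H _]]]] := cauchy_riemann dh 0 t.
move: H; rewrite (_ : (fun t => _) = (fun t => Re (g (cos t +i* sin t))))//.
by apply/funext => x; rewrite /h /cexp/= expR0 mul1r.
Qed.

Lemma integral_circle (g : C -> C) :
  (forall z : C^o, differentiable (g : C^o -> C^o) z) ->
  (\int[mu]_(t in `[0%R, (2 * pi)%R]) (Re (g (cos t +i* sin t)))%:E =
   (2 * pi * Re (g 0))%:E)%E.
Proof.
move=> dg; rewrite -circle_mean// fineK//.
by apply: integrable_fin_num => //; exact: integrable_circle.
Qed.

End circle.

(** * Measurability of continuous functions on C^n *)

Section measurability.
Variables (R : realType) (n : nat).
Local Notation C := R[i].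
Local Notation normc := ComplexField.Normc.normc.
Local Notation Re := complex.Re.
Local Notation Im := complex.Im.
Local Notation T := (measurableTypeR R).
Local Notation Tn := (n.-tuple T).

Lemma measurable_countable_code d d' (X : measurableType d)
    (Y : measurableType d') (S : countType) (q : X -> S) (g : S -> Y) :
  (forall c, measurable (q @^-1` [set c])) -> measurable_fun setT (g \o q).
Proof.
move=> mq _ B mB; rewrite setTI.
have -> : (g \o q) @^-1` B =
    \bigcup_c (if `[< B (g c) >] then q @^-1` [set c] else set0).
  apply/seteqP; split => [x Bx|x [c _]].
    by exists (q x) => //; case: asboolP.
  by case: asboolP => // Bc /= ->.
apply: countable_bigcupT_measurable => [|c]; first exact: countableP.
by case: ifP.
Qed.

Definition tuple_floor k (x : Tn) : n.-tuple int :=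
  [tuple Num.floor (tnth x i * 2 ^+ k : R) | i < n].

Definition tuple_unfloor k (c : n.-tuple int) : Tn :=
  [tuple (tnth c i)%:~R / 2 ^+ k : R | i < n].

Lemma measurable_tuple_floor k c : measurable (tuple_floor k @^-1` [set c]).
Proof.
have -> : tuple_floor k @^-1` [set c] = \bigcap_(i in [set: 'I_n])
    ((fun x : Tn => tnth x i * 2 ^+ k : R) @^-1`
      `[(tnth c i)%:~R, (tnth c i + 1)%:~R[%classic).
  apply/seteqP; split => [x /= <- i _|x h].
    by rewrite /= in_itv/= /tuple_floor tnth_mktuple floor_itv.
  apply: eq_from_tnth => i; rewrite tnth_mktuple; apply: floor_def.
  by have := h i I; rewrite /= in_itv.
apply: fin_bigcap_measurable => // i _; rewrite -[X in measurable X]setTI.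
suff : measurable_fun setT (fun x : Tn => tnth x i * 2 ^+ k : R) by exact.
by apply: measurable_funM => //; exact: measurable_tnth.
Qed.

Lemma tuple_floorK k (x : Tn) i :
  `|tnth (tuple_unfloor k (tuple_floor k x)) i - tnth x i| <= 2 ^- k.
Proof.
rewrite !tnth_mktuple.
have /andP[h1 h2] := floor_itv (tnth x i * 2 ^+ k : R).
have k0 : 0 < 2 ^+ k :> R by rewrite exprn_gt0.
rewrite -(ler_pM2r k0) -[X in _ * X <= _](ger0_norm (ltW k0)) -normrM mulrBl.
rewrite divfK ?gt_eqF// mulVf ?gt_eqF//.
by move: h2; rewrite intrD ler_norml => h2; apply/andP; split; lra.
Qed.

(** The sigma-algebra on tuples is generated by the coordinates, not by open
    sets.  Rounding all coordinates down to multiples of [2 ^- k] gives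
    measurable maps with countably many values, so [f] is a pointwise limit of
    measurable functions. *)
Lemma measurable_continuous_Cn (f : Tn * Tn -> R) :
  (forall p e, 0 < e -> exists2 d, 0 < d & forall q : Tn * Tn,
    (forall i, `|tnth q.1 i - tnth p.1 i : R| < d /\
               `|tnth q.2 i - tnth p.2 i : R| < d) -> `|f q - f p| < e) ->
  measurable_fun setT f.
Proof.
move=> cf.
pose code k (p : Tn * Tn) := (tuple_floor k p.1, tuple_floor k p.2).
pose uncode k c : Tn * Tn := (tuple_unfloor k c.1, tuple_unfloor k c.2).
apply: (@measurable_fun_cvg _ _ _ _ (fun k => (f \o uncode k) \o code k)).
  move=> k; apply: measurable_countable_code => -[c1 c2].
  rewrite (_ : _ @^-1` _ = (tuple_floor k @^-1` [set c1]) `*`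
      (tuple_floor k @^-1` [set c2])).
    by apply: measurableX; exact: measurable_tuple_floor.
  apply/seteqP; split => -[x y] /=; first by case=> -> ->.
  by move=> [<- <-].
move=> p _; apply/cvgrPdist_lt => e e0; have [d d0 hd] := cf p e e0.
have := @cvg_geometric R 1 2^-1 ltac:(by rewrite ger0_norm; lra).
move/cvgrPdist_lt => /(_ d d0) [k0 _ hk0]; exists k0 => // k kk.
have {hk0} := hk0 k kk; rewrite /= sub0r normrN /geometric/= exprVn mul1r => hk.
have {}hk := le_lt_trans (ler_norm _) hk.
rewrite distrC; apply: hd => i; split;
  by apply: le_lt_trans (tuple_floorK _ _ _) hk.
Qed.

Lemma continuous_rV_eps (F : 'rV[C]_n -> C) (z : 'rV[C^o]_n) :
  {for z, continuous (F : 'rV[C^o]_n -> C^o)} ->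
  forall e : R, 0 < e -> exists2 d : R, 0 < d & forall w : 'rV[C]_n,
    (forall j, normc (w 0 j - z 0 j) < d) -> normc (F w - F z) < e.
Proof.
move=> /cvgrPdist_lt cF e e0; have := cF e%:C; rewrite ltcR => /(_ e0).
move=> /nbhs_ballP[d /=]; rewrite ltcE/= => /andP[/eqP d1 d0] hd.
have dE : d = (complex.Re d)%:C by case: d d1 {d0 hd} => a b /= ->.
exists (complex.Re d) => // w hw.
have : ball z d w.
  split; first by rewrite dE ltcR.
  move=> i j; rewrite (ord1 i) -ball_normE /ball_ /= dE distrC normr_normc ltcR.
  exact: hw.
by move=> /hd/=; rewrite distrC normr_normc ltcR.
Qed.

Lemma continuous_cvec (F : 'rV[C]_n -> C) :
  (forall z : 'rV[C^o]_n, {for z, continuous (F : 'rV[C^o]_n -> C^o)}) ->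
  forall (p : Tn * Tn) (e : R), 0 < e ->
  exists2 d : R, 0 < d & forall q : Tn * Tn,
    (forall i, `|tnth q.1 i - tnth p.1 i : R| < d /\
               `|tnth q.2 i - tnth p.2 i : R| < d) ->
    normc (F (cvec q.1 q.2) - F (cvec p.1 p.2)) < e.
Proof.
move=> cF p e e0; have [d d0 hd] := continuous_rV_eps (cF (cvec p.1 p.2)) e0.
exists (d / 2); first by rewrite divr_gt0.
move=> q hq; apply: hd => j; rewrite !mxE.
apply: le_lt_trans (normc_le_ReIm _) _ => /=.
by have [? ?] := hq j; lra.
Qed.

Lemma measurable_Re_cvec (F : 'rV[C]_n -> C) :
  (forall z : 'rV[C^o]_n, {for z, continuous (F : 'rV[C^o]_n -> C^o)}) ->
  measurable_fun setT (fun p : Tn * Tn => Re (F (cvec p.1 p.2))).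
Proof.
move=> cF; apply: measurable_continuous_Cn => p e e0.
have [d d0 hd] := continuous_cvec cF p e0.
exists d => // q /hd; apply: le_lt_trans.
by apply: le_trans (normr_Re_le _); case: (F _) (F _) => [? ?] [? ?].
Qed.

Lemma measurable_normc_cvec (F : 'rV[C]_n -> C) :
  (forall z : 'rV[C^o]_n, {for z, continuous (F : 'rV[C^o]_n -> C^o)}) ->
  measurable_fun setT (fun p : Tn * Tn => normc (F (cvec p.1 p.2))).
Proof.
move=> cF; apply: measurable_continuous_Cn => p e e0.
have [d d0 hd] := continuous_cvec cF p e0.
exists d => // q /hd; apply: le_lt_trans.
have := ler_dist_dist (F (cvec q.1 q.2)) (F (cvec p.1 p.2)).
rewrite !normr_normc -rmorphB/= lecE/= => /andP[_].
by rewrite expr0n addr0 sqrtr_sqr.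
Qed.

End measurability.

(** * Gaussian integrals *)

Section gaussian.
Variable R : realType.
Local Notation T := (measurableTypeR R).
Local Notation mu := (@lebesgue_measure R).
Implicit Types (n : nat) (s : R).

(** Up to a constant this is the normal density of variance [1 / (2 s)]. *)
Lemma integral_gauss_R s : 0 < s ->
  exists2 K : R, 0 < K & (\int[mu]_x (expR (- (s * x ^+ 2)))%:E = K%:E)%E.
Proof.
move=> s0; pose sg := Num.sqrt (2 * s)^-1.
have s20 : 0 < (2 * s)^-1 by rewrite invr_gt0 mulr_gt0.
have sg0 : sg != 0 by rewrite gt_eqF// sqrtr_gt0.
have sg2 : sg ^+ 2 = (2 * s)^-1 by rewrite sqr_sqrtr// ltW.
have pk := normal_peak_gt0 sg0.
exists (normal_peak sg)^-1; first by rewrite invr_gt0.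
have := integral_normal_pdf 0 sg; rewrite normal_pdfE//.
under eq_integral do rewrite EFinM.
rewrite ge0_integralZl_EFin//; last 3 first.
- by move=> x _; rewrite lee_fin normal_fun_ge0.
- by apply/measurable_EFinP; exact: measurable_normal_fun.
- exact: ltW.
have -> : (\int[mu]_x (normal_fun 0 sg x)%:E =
    \int[mu]_x (expR (- (s * x ^+ 2)))%:E)%E.
  apply: eq_integral => x _; rewrite /normal_fun subr0 sg2; congr (expR _)%:E.
  by field; rewrite gt_eqF.
move=> h; have := congr1 (fun x => (normal_peak sg)^-1%:E * x)%E h.
by rewrite muleA -EFinM mulVf ?gt_eqF// mul1e mule1.
Qed.

Lemma measurable_sqnormr n :
  measurable_fun setT (fun x : n.-tuple T => sqnormr x).
Proof.
apply: measurable_sum => i; apply: measurable_funX; exact: measurable_tnth.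
Qed.

Lemma measurable_gauss_Rn n s :
  measurable_fun setT (fun x : n.-tuple T => expR (- (s * sqnormr x))).
Proof.
apply: measurableT_comp => //; apply: measurable_funN.
by apply: measurable_funM => //; exact: measurable_sqnormr.
Qed.

Lemma integral_gauss_Rn n s : 0 < s -> exists2 K : R, 0 < K &
  (\int[lebesgue_Rn R n]_x (expR (- (s * sqnormr x)))%:E = K%:E)%E.
Proof.
move=> s0; have [K1 K10 hK1] := integral_gauss_R s0.
elim: n => [|n [K K0 hK]].
  exists 1 => //; rewrite integral_dirac//; last first.
    by apply/measurable_EFinP; exact: measurable_gauss_Rn.
  by rewrite diracT mul1e /sqnormr big_ord0 mulr0 oppr0 expR0.
exists (K1 * K); first by rewrite mulr_gt0.
rewrite /lebesgue_Rn /= /product_cons.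
rewrite ge0_integral_pushforward//; last 2 first.
- exact: measurable_tuple_cons.
- by apply/measurable_EFinP; exact: measurable_gauss_Rn.
rewrite preimage_setT fubini_tonelli1//; last 2 first.
- apply: measurableT_comp; last exact: measurable_tuple_cons.
  by apply/measurable_EFinP; exact: measurable_gauss_Rn.
- by move=> x /=; rewrite lee_fin expR_ge0.
transitivity (\int[mu]_x (K%:E * (expR (- (s * x ^+ 2)))%:E))%E.
  apply: eq_integral => x _.
  rewrite /fubini_F -hK muleC -ge0_integralZl_EFin//; last first.
    by apply/measurable_EFinP; exact: measurable_gauss_Rn.
  apply: eq_integral => y _ /=; rewrite -EFinM -expRD; congr (expR _)%:E.
  rewrite /sqnormr big_ord_recl tnth0 mulrDr opprD; congr (_ - _ * _).
  by apply: eq_bigr => i _; rewrite tnthS.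
rewrite ge0_integralZl_EFin//; last 2 first.
- apply/measurable_EFinP; apply: measurableT_comp => //; apply: measurable_funN.
  by apply: measurable_funM => //; exact: measurable_funX.
- exact: ltW.
by rewrite hK1 -EFinM mulrC.
Qed.

Lemma measurable_sqnormr_Cn n : measurable_fun setT
  (fun p : n.-tuple T * n.-tuple T => sqnormr p.1 + sqnormr p.2).
Proof.
apply: measurable_funD.
  exact: (measurableT_comp (@measurable_sqnormr n) measurable_fst).
exact: (measurableT_comp (@measurable_sqnormr n) measurable_snd).
Qed.

Lemma measurable_gauss_Cn n s : measurable_fun setT
  (fun p : n.-tuple T * n.-tuple T =>
    expR (- (s * (sqnormr p.1 + sqnormr p.2)))).
Proof.
apply: measurableT_comp => //; apply: measurable_funN.
by apply: measurable_funM => //; exact: measurable_sqnormr_Cn.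
Qed.

Lemma integral_gauss_Cn n s : 0 < s -> exists2 K : R, 0 < K &
  (\int[lebesgue_Cn R n]_p
     (expR (- (s * (sqnormr p.1 + sqnormr p.2))))%:E = K%:E)%E.
Proof.
move=> s0; have [K K0 hK] := integral_gauss_Rn n s0.
exists (K * K); first by rewrite mulr_gt0.
rewrite /lebesgue_Cn fubini_tonelli1//; last first.
  by apply/measurable_EFinP; exact: measurable_gauss_Cn.
transitivity (\int[lebesgue_Rn R n]_x (K%:E * (expR (- (s * sqnormr x)))%:E))%E.
  apply: eq_integral => x _.
  rewrite /fubini_F -hK muleC -ge0_integralZl_EFin//; last first.
    by apply/measurable_EFinP; exact: measurable_gauss_Rn.
  by apply: eq_integral => y _ /=; rewrite -EFinM -expRD mulrDr opprD.
rewrite ge0_integralZl_EFin//; last 2 first.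
- by apply/measurable_EFinP; exact: measurable_gauss_Rn.
- exact: ltW.
by rewrite hK -EFinM.
Qed.

(** Complete the square and translate by [y / s]. *)
Lemma integral_gauss_linear_Rn n s (y : n.-tuple R) : 0 < s ->
  (\int[lebesgue_Rn R n]_q
     (expR (2 * (\sum_i tnth q i * tnth y i) - s * sqnormr q))%:E =
   (expR (sqnormr y / s))%:E *
   \int[lebesgue_Rn R n]_x (expR (- (s * sqnormr x)))%:E)%E.
Proof.
move=> s0.
rewrite -ge0_integralZl_EFin//; last first.
  by apply/measurable_EFinP; exact: measurable_gauss_Rn.
pose c : n.-tuple R := [tuple - (tnth y i / s) | i < n].
have mg : measurable_fun setT (fun x : n.-tuple T =>
    ((expR (sqnormr y / s))%:E * (expR (- (s * sqnormr x)))%:E)%E).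
  under eq_fun do rewrite -EFinM.
  apply/measurable_EFinP; apply: measurable_funM => //.
  exact: measurable_gauss_Rn.
rewrite -(ge0_integral_preserving (lebesgue_Rn_translation c))//.
apply: eq_integral => q _; rewrite -EFinM -expRD; congr (expR _)%:E.
rewrite /sqnormr !mulr_sumr mulr_suml -!sumrN -!big_split/=.
apply: eq_bigr => i _; rewrite !tnth_mktuple; field.
by rewrite gt_eqF.
Qed.

End gaussian.

(** * Means against rotation-invariant weights *)

Section radial_mean.
Variables (R : realType) (n : nat).
Local Notation C := R[i].
Local Notation Re := complex.Re.
Local Notation Im := complex.Im.
Local Notation T := (measurableTypeR R).
Local Notation Tn := (n.-tuple T).
Local Notation mu := (@lebesgue_measure R).
Local Notation Cn := (lebesgue_Cn R n).
Implicit Types (p : Tn * Tn) (c s t : R).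

Lemma cvec_cmul c s p :
  cvec (cmul c s p).1 (cmul c s p).2 = (c +i* s) *: cvec p.1 p.2.
Proof.
by apply/rowP => j; rewrite !mxE !tnth_mktuple/=; simpc; congr (_ +i* _); ring.
Qed.

Lemma sqnormr_cmul c s p : c ^+ 2 + s ^+ 2 = 1 ->
  sqnormr (cmul c s p).1 + sqnormr (cmul c s p).2 = sqnormr p.1 + sqnormr p.2.
Proof.
move=> cs; rewrite /sqnormr -!big_split/=; apply: eq_bigr => i _.
rewrite !tnth_mktuple -[RHS]mul1r -cs; ring.
Qed.

Lemma entire_ray (F : 'rV[C]_n -> C) (v : 'rV[C]_n) : entire F ->
  forall z : C^o, differentiable ((fun z : C => F (z *: v)) : C^o -> C^o) z.
Proof.
move=> dF z.
pose l : C^o -> 'rV[C^o]_n := fun z => z *: (v : 'rV[C^o]_n).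
have dl : differentiable l z by [].
exact: (@differentiable_comp _ _ _ _ l (F : 'rV[C^o]_n -> C^o) z dl (dF (l z))).
Qed.

Lemma entire_continuous (F : 'rV[C]_n -> C) : entire F ->
  forall z : 'rV[C^o]_n, {for z, continuous (F : 'rV[C^o]_n -> C^o)}.
Proof. by move=> dF z; apply: differentiable_continuous; exact: dF. Qed.

(** Integrate [F (e^(i t) p) * W p] over [t] in [[0, 2 pi]] and [p] in C^n.
    Integrating first over [t] gives [2 pi * F 0 * W p] by the mean value
    property on circles; integrating first over [p] gives [2 pi] times the
    integral of [F * W], since [W] and the measure are rotation invariant. *)
Lemma radial_mean (F : 'rV[C]_n -> C) (W : Tn * Tn -> R) : entire F ->
  measurable_fun setT W ->
  (forall c s p, c ^+ 2 + s ^+ 2 = 1 -> W (cmul c s p) = W p) ->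
  Cn.-integrable setT (EFin \o W) ->
  Cn.-integrable setT (fun p => (Re (F (cvec p.1 p.2)) * W p)%:E) ->
  (\int[Cn]_p (Re (F (cvec p.1 p.2)) * W p)%:E =
   (Re (F 0))%:E * \int[Cn]_p (W p)%:E)%E.
Proof.
move=> dF mW Wrot iW iFW.
pose I : set T := `[0, 2 * pi]%classic.
have mI : measurable I by exact: measurable_itv.
have pi20 : 0 < 2 * pi :> R by rewrite mulr_gt0// pi_gt0.
have muI : mu I = (2 * pi)%:E.
  by rewrite /I lebesgue_measure_itv/= lte_fin pi20 sube0.
have integralI (r : \bar R) : (\int[mu]_(t in I) r = (2 * pi)%:E * r)%E.
  by rewrite integral_cst// muleC; congr (_ * _)%E.
have mF : measurable_fun setT (fun p => Re (F (cvec p.1 p.2))).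
  by apply: measurable_Re_cvec; exact: entire_continuous.
pose rot (q : (Tn * Tn) * T) := cmul (cos q.2) (sin q.2) q.1.
have mrot : measurable_fun setT rot.
  have mcos : measurable_fun setT (fun q : (Tn * Tn) * T => cos (q.2 : R)).
    apply: measurableT_comp => //.
    by apply: continuous_measurable_fun; exact: continuous_cos.
  have msin : measurable_fun setT (fun q : (Tn * Tn) * T => sin (q.2 : R)).
    apply: measurableT_comp => //.
    by apply: continuous_measurable_fun; exact: continuous_sin.
  have m1 : measurable_fun setT (fun q : (Tn * Tn) * T => q.1.1).
    exact: measurableT_comp.
  have m2 : measurable_fun setT (fun q : (Tn * Tn) * T => q.1.2).
    exact: measurableT_comp.
  apply: measurable_fun_pair; apply: measurable_lincomb => //.
  exact: measurable_funN.
have cs1 t : cos t ^+ 2 + sin t ^+ 2 = 1 by exact: cos2Dsin2.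
pose G p := Re (F (cvec p.1 p.2)) * W p.
have mG : measurable_fun setT G by exact: measurable_funM.
pose H (q : (Tn * Tn) * T) : \bar R := (\1_I q.2 * G (rot q))%:E.
have mH : measurable_fun setT H.
  apply/measurable_EFinP; apply: measurable_funM.
    by apply: measurableT_comp => //; exact: measurable_indic.
  exact: measurableT_comp.
have patchH (f : T -> \bar R) :
    (\int[mu]_t ((\1_I t)%:E * f t) = \int[mu]_(t in I) f t)%E.
  rewrite [RHS]integral_mkcond; apply: eq_integral => t _.
  by rewrite patchE indicE; case: (t \in I); rewrite ?mul1e ?mul0e.
have iH : (Cn \x mu)%E.-integrable setT H.
  apply/integrable21ltyP => //.
  rewrite (_ : (\int[mu]_y _)%E = \int[mu]_(t in I) \int[Cn]_p `|(G p)%:E|)%E.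
    rewrite integralI; apply: lte_mul_pinfty => //.
    - by rewrite lee_fin ltW.
    - by move/integrableP: iFW => [].
  rewrite -patchH; apply: eq_integral => t _.
  have mabsG : measurable_fun setT (fun p => `|(G p)%:E|%E).
    by apply: measurableT_comp => //; exact/measurable_EFinP.
  have E := ge0_integral_preserving (measure_preserving_cmul n (cs1 t)) mabsG
    (fun=> abse_ge0 _).
  rewrite -[X in (_ * X)%E]E.
  rewrite /H indicE; case: (t \in I) => /=.
    by rewrite mul1e; apply: eq_integral => p _; rewrite mul1r.
  rewrite mul0e; under eq_integral do rewrite mul0r normr0.
  by rewrite integral0.
have := Fubini iH.
have -> : (\int[Cn]_p \int[mu]_t H (p, t) =
    (2 * pi)%:E * ((Re (F 0))%:E * \int[Cn]_p (W p)%:E))%E.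
  rewrite muleA -EFinM -integralZl//; apply: eq_integral => p _.
  transitivity (\int[mu]_(t in I) ((W p)%:E *
      (Re (F ((cos t +i* sin t) *: cvec p.1 p.2)))%:E))%E.
    rewrite -patchH; apply: eq_integral => t _.
    by rewrite /H -!EFinM /G /rot/= cvec_cmul Wrot// [W p * _]mulrC.
  rewrite integralZl//; last exact: integrable_circle (entire_ray _ dF).
  by rewrite (integral_circle (entire_ray _ dF)) scale0r muleC.
have -> : (\int[mu]_t \int[Cn]_p H (p, t) =
    (2 * pi)%:E * \int[Cn]_p (G p)%:E)%E.
  transitivity (\int[mu]_(t in I) \int[Cn]_p (G p)%:E)%E.
    rewrite -patchH; apply: eq_integral => t _.
    have mEG : measurable_fun setT (EFin \o G) by exact/measurable_EFinP.
    rewrite -[X in (_ * X)%E](integral_preserving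
      (measure_preserving_cmul n (cs1 t)) mEG).
    rewrite /H indicE; case: (t \in I) => /=.
      by rewrite mul1e; apply: eq_integral => p _; rewrite mul1r.
    by rewrite mul0e; under eq_integral do rewrite mul0r; rewrite integral0.
  by rewrite integralI.
move=> h; have cancel (y : \bar R) : ((2 * pi)^-1%:E * ((2 * pi)%:E * y) = y)%E.
  by rewrite muleA -EFinM mulVf ?gt_eqF// mul1e.
by rewrite -[LHS]cancel -[RHS]cancel h.
Qed.

End radial_mean.

(** * The image of the kernels under the operator *)

Section reproducing.
Variables (R : realType) (n : nat).
Local Notation C := R[i].
Local Notation Re := complex.Re.
Local Notation Im := complex.Im.
Local Notation normc := ComplexField.Normc.normc.
Local Notation T := (measurableTypeR R).
Local Notation Tn := (n.-tuple T).
Local Notation Cn := (lebesgue_Cn R n).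
Implicit Types (p : Tn * Tn) (z w a b m zeta : 'rV[C]_n).

Lemma dotc_conjv z : dotc z (conjv z) = (sqnormc z)%:C.
Proof.
rewrite /sqnormc; have : Im (dotc z (conjv z)) = 0.
  rewrite /dotc; elim/big_rec: _ => // j x _.
  by rewrite mxE; case: (z 0 j) x => [u v] [x y] /= ->; ring.
by case: (dotc _ _) => u v /= ->.
Qed.

Lemma sqnormc_cvec (x y : n.-tuple R) :
  sqnormc (cvec x y) = sqnormr x + sqnormr y.
Proof.
rewrite /sqnormc /dotc /sqnormr raddf_sum -big_split/=.
by apply: eq_bigr => j _; rewrite !mxE/=; ring.
Qed.

Lemma Re_half (c : C) : Re (2^-1 * c) = 2^-1 * Re c.
Proof.
have -> : (2^-1 : C) = (2^-1 : R)%:C by rewrite fmorphV rmorph_nat.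
by case: c => u v /=; ring.
Qed.

Lemma sqnormcE z : sqnormc z = \sum_j (Re (z 0 j) ^+ 2 + Im (z 0 j) ^+ 2).
Proof.
rewrite /sqnormc /dotc raddf_sum; apply: eq_bigr => j _.
by rewrite !mxE; case: (z 0 j) => u v /=; ring.
Qed.

Lemma cexp_real (x : R) : cexp x%:C = (expR x)%:C.
Proof. by rewrite /cexp/= cos0 sin0 mulr1. Qed.

Lemma w0E z :
  (w0 z)%:C = ((2 * pi) ^- n)%:C * cexp (- (2^-1 * dotc z (conjv z))).
Proof.
rewrite /w0 rmorphM/= dotc_conjv; congr (_ * _).
by rewrite -cexp_real; congr cexp; rewrite rmorphN rmorphM/= fmorphV rmorph_nat.
Qed.

(** The entire factor [E] of the integrand of [S_phi K_a] at [z], after the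
    substitution [zeta = conjv (a - w)]; the other factor is [w0 zeta]. *)
Definition recentred_symbol (phi : 'rV[C]_n -> C) z a zeta : C :=
  phi (z - conjv a + zeta) *
  cexp (2^-1 * (dotc z (conjv a) + dotc zeta (a - z))).

(** All factors except the one with [phi] are exponentials, so the identity
    reduces to comparing exponents. *)
Lemma S_op_integrand (phi : 'rV[C]_n -> C) z a w :
  fock_kernel a w * phi (z - conjv w) * cexp (2^-1 * dotc z (conjv w)) *
    (w0 w)%:C =
  recentred_symbol phi z a (conjv (a - w)) * (w0 (conjv (a - w)))%:C.
Proof.
have -> : z - conjv w = z - conjv a + conjv (a - w).
  by apply/rowP => j; rewrite !mxE rmorphB/=; ring.
rewrite /recentred_symbol /fock_kernel !w0E; set c := _%:C; set f := phi _.
transitivity (c * f * cexp (2^-1 * dotc w (conjv a) + 2^-1 * dotc z (conjv w) +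
   - (2^-1 * dotc w (conjv w)))).
  by rewrite !cexpD; ring.
transitivity (c * f * cexp (
   2^-1 * (dotc z (conjv a) + dotc (conjv (a - w)) (a - z)) +
   - (2^-1 * dotc (conjv (a - w)) (conjv (conjv (a - w)))))); last first.
  by rewrite !cexpD; ring.
congr (_ * cexp _); rewrite -mulrDr -!mulrBr; congr (_ * _).
rewrite /dotc -!sumrN -!big_split/=; apply: eq_bigr => j _.
rewrite !mxE !rmorphB/= ?conjcK.
move: (conjc (a 0 j)) (conjc (w 0 j)) => a' w'; ring.
Qed.

Lemma entire_recentred_symbol (phi : 'rV[C]_n -> C) z a :
  entire phi -> entire (recentred_symbol phi z a).
Proof.
move=> dphi x.
pose t : 'rV[C^o]_n -> 'rV[C^o]_n := fun u => (z - conjv a : 'rV[C^o]_n) + u.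
pose l : 'rV[C^o]_n -> C^o :=
  fun u => 2^-1 * (dotc z (conjv a) + dotc u (a - z)).
have dt : differentiable t x by [].
have dl : differentiable l x.
  have dd : differentiable (fun u : 'rV[C^o]_n => dotc u (a - z) : C^o) x.
    rewrite (_ : (fun u => _) = \sum_(j < n)
      (fun u : 'rV[C^o]_n => (a - z) 0 j *: (u 0 j : C^o))); last first.
      apply/funext => u; rewrite fct_sumE; apply: eq_bigr => j _.
      by rewrite mulrC.
    apply: differentiable_sum => j; apply: differentiableZ.
    exact: differentiable_coord.
  apply: (@differentiableZ _ _ _
    (fun u : 'rV[C^o]_n => dotc z (conjv a) + dotc u (a - z) : C^o)).
  exact: differentiableD.
apply: (@differentiableM _ _ ((phi : 'rV[C^o]_n -> C^o) \o t)
  ((@cexp R : C^o -> C^o) \o l)).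
  exact: (@differentiable_comp _ _ _ _ t (phi : 'rV[C^o]_n -> C^o) x dt
    (dphi (t x))).
exact: (@differentiable_comp _ _ _ _ l (@cexp R : C^o -> C^o) x dl
  (differentiable_cexp (l x))).
Qed.

End reproducing.

Lemma ge0_integrable d (X : measurableType d) (R : realType)
    (mu : {measure set X -> \bar R}) (f : X -> R) :
  measurable_fun setT f -> (forall x, 0 <= f x) ->
  (\int[mu]_x (f x)%:E < +oo)%E -> mu.-integrable setT (fun x => (f x)%:E).
Proof.
move=> mf f0 foo; apply/integrableP; split; first exact/measurable_EFinP.
rewrite (eq_integral (fun x => (f x)%:E))// => x _.
by rewrite gee0_abs// lee_fin.
Qed.

Section kernel_image.
Variables (R : realType) (n : nat).
Local Notation C := R[i].
Local Notation Re := complex.Re.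
Local Notation Im := complex.Im.
Local Notation normc := ComplexField.Normc.normc.
Local Notation T := (measurableTypeR R).
Local Notation Tn := (n.-tuple T).
Local Notation Cn := (lebesgue_Cn R n).
Implicit Types (p : Tn * Tn) (z w a b m zeta : 'rV[C]_n).

Definition coords z : Tn * Tn :=
  ([tuple Re (z 0 j) | j < n], [tuple Im (z 0 j) | j < n]).

Lemma cvec_translate b p :
  cvec (translate (coords b) p).1 (translate (coords b) p).2 = b + cvec p.1 p.2.
Proof.
apply/rowP => j; rewrite !mxE !tnth_mktuple.
by case: (b 0 j) => u v /=; simpc; congr (_ +i* _); ring.
Qed.

Lemma w0_cst_gt0 : 0 < (2 * pi) ^- n :> R.
Proof. by rewrite invr_gt0 exprn_gt0// mulr_gt0// pi_gt0. Qed.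

Lemma w0_gt0 z : 0 < w0 z.
Proof. by rewrite mulr_gt0 ?expR_gt0// w0_cst_gt0. Qed.

Lemma w0_cvec p : w0 (cvec p.1 p.2) =
  (2 * pi) ^- n * expR (- (2^-1 * (sqnormr p.1 + sqnormr p.2))).
Proof. by rewrite /w0 sqnormc_cvec. Qed.

Lemma measurable_w0 : measurable_fun setT (fun p => w0 (cvec p.1 p.2)).
Proof.
under eq_fun do rewrite w0_cvec.
by apply: measurable_funM => //; exact: measurable_gauss_Cn.
Qed.

Lemma integral_w0 : exists2 kappa : R, 0 < kappa &
  (\int[Cn]_p (w0 (cvec p.1 p.2))%:E = kappa%:E)%E.
Proof.
have s0 : 0 < 2^-1 :> R by rewrite invr_gt0.
have [K K0 hK] := integral_gauss_Cn n s0.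
have c0 := w0_cst_gt0.
exists ((2 * pi) ^- n * K); first by rewrite mulr_gt0.
under eq_integral do rewrite w0_cvec EFinM.
rewrite ge0_integralZl_EFin//; last 2 first.
- by apply/measurable_EFinP; exact: measurable_gauss_Cn.
- exact: ltW.
by rewrite hK EFinM.
Qed.

Lemma integrable_w0 : Cn.-integrable setT (fun p => (w0 (cvec p.1 p.2))%:E).
Proof.
apply: ge0_integrable; first exact: measurable_w0.
  by move=> p; rewrite ltW// w0_gt0.
by have [K _ ->] := integral_w0; exact: ltry.
Qed.

Lemma integrable_gauss_Cn (s : R) : 0 < s -> Cn.-integrable setT
  (fun p => (expR (- (s * (sqnormr p.1 + sqnormr p.2))))%:E).
Proof.
move=> s0; apply: ge0_integrable => [|p|]; first exact: measurable_gauss_Cn.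
- exact: expR_ge0.
- by have [K _ ->] := integral_gauss_Cn n s0; exact: ltry.
Qed.

Lemma fock_density_ge0 (F : 'rV[C]_n -> C) z : 0 <= normc (F z) ^+ 2 * w0 z.
Proof. by rewrite mulr_ge0 ?sqr_ge0// ltW// w0_gt0. Qed.

Lemma fock_integral_lty (F : 'rV[C]_n -> C) : fock F ->
  (\int[Cn]_p (normc (F (cvec p.1 p.2)) ^+ 2 * w0 (cvec p.1 p.2))%:E < +oo)%E.
Proof.
move=> [_]; rewrite /fock_norm /integral_Cn; set I := (\int[_]_p _)%E => h.
have I0 : (0 <= I)%E.
  by apply: integral_ge0 => p _; rewrite lee_fin fock_density_ge0.
rewrite -(sqr_sqrte I0) -ge0_fin_numE ?sqre_ge0//.
by rewrite fin_numX// ge0_fin_numE// sqrte_ge0.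
Qed.

Lemma measurable_fock_density (F : 'rV[C]_n -> C) : entire F ->
  measurable_fun setT
    (fun p => normc (F (cvec p.1 p.2)) ^+ 2 * w0 (cvec p.1 p.2)).
Proof.
move=> dF; apply: measurable_funM; last exact: measurable_w0.
apply: measurable_funX; apply: measurable_normc_cvec; exact: entire_continuous.
Qed.

Variables (phi : 'rV[C]_n -> C) (fphi : fock phi).
Variables (z a : 'rV[C]_n).
Let E := recentred_symbol phi z a.
Let b := z - conjv a.

(** If [v] is the exponential factor of [E zeta], then up to a constant
    [expR (exponent zeta)] is [|v| ^+ 2 * w0 zeta ^+ 2 / w0 (b + zeta)]. *)
Let exponent zeta : R :=
  2 * Re (2^-1 * (dotc z (conjv a) + dotc zeta (a - z))) - sqnormc zeta
  + 2^-1 * sqnormc (b + zeta).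

Lemma exponent_bound : exists K, forall zeta,
  exponent zeta <= K - 4^-1 * sqnormc zeta.
Proof.
pose m := a - z.
(* the last two squares complete u^2 / 4 - (m1 + b1) u and
   v^2 / 4 - (b2 - m2) v, where zeta_j = u + i v *)
exists (\sum_j (Re (z 0 j * conjc (a 0 j)) +
  2^-1 * (Re (b 0 j) ^+ 2 + Im (b 0 j) ^+ 2) +
  (Re (m 0 j) + Re (b 0 j)) ^+ 2 + (Im (b 0 j) - Im (m 0 j)) ^+ 2)) => zeta.
rewrite /exponent.
have -> : 2 * Re (2^-1 * (dotc z (conjv a) + dotc zeta (a - z))) =
    \sum_j (Re (z 0 j * conjc (a 0 j)) + Re (zeta 0 j * m 0 j)).
  rewrite [dotc z _]/dotc [dotc zeta _]/dotc -big_split/=.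
  rewrite Re_half mulVKf// raddf_sum; apply: eq_bigr => j _; rewrite raddfD/=.
  by rewrite [conjv a 0 j]mxE.
rewrite !sqnormcE !mulr_sumr -!sumrN -!big_split/=; apply: ler_sum => j _.
rewrite -subr_ge0.
have -> : (b + zeta) 0 j = b 0 j + zeta 0 j by rewrite mxE.
move: (z 0 j * _) (b 0 j) (m 0 j) (zeta 0 j) => [c ?] [b1 b2] [m1 m2] [u v] /=.
set x := (X in 0 <= X).
have -> : x = (u / 2 - (m1 + b1)) ^+ 2 + (v / 2 - (b2 - m2)) ^+ 2.
  by rewrite /x; field.
by rewrite addr_ge0// sqr_ge0.
Qed.

(** By [X * Y <= X ^+ 2 * A + Y ^+ 2 / A] with [A = w0 (b + zeta)], the
    integrand is dominated by a translate of the density of [phi] in the Fock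
    norm plus a Gaussian. *)
Lemma integrable_recentred_symbol : Cn.-integrable setT
  (fun p => (normc (E (cvec p.1 p.2)) * w0 (cvec p.1 p.2))%:E).
Proof.
have [dphi _] := fphi.
have dE := entire_recentred_symbol z a dphi.
have [K hK] := exponent_bound.
pose f p := normc (phi (cvec p.1 p.2)) ^+ 2 * w0 (cvec p.1 p.2).
pose g p :=
  (2 * pi) ^- n * expR K * expR (- (4^-1 * (sqnormr p.1 + sqnormr p.2))).
have mf : measurable_fun setT f by exact: measurable_fock_density.
have mT := measure_preserving_translate (coords b).
have iphi : Cn.-integrable setT (fun p => (f (translate (coords b) p))%:E).
  apply: ge0_integrable => [|p|].
  - by apply: measurableT_comp => //; exact: mT.1.
  - exact: fock_density_ge0.
  have mEf : measurable_fun setT (EFin \o f) by exact/measurable_EFinP.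
  have -> := @ge0_integral_preserving _ _ _ _ _ (EFin \o f) mT mEf.
    exact: fock_integral_lty.
  by move=> p; rewrite lee_fin fock_density_ge0.
have ig : Cn.-integrable setT (fun p => (g p)%:E).
  under eq_fun do rewrite /g EFinM.
  by apply: integrableZl => //; apply: integrable_gauss_Cn; rewrite invr_gt0.
apply: le_integrable (integrableD _ iphi ig) => //.
  apply/measurable_EFinP; apply: measurable_funM; last exact: measurable_w0.
  apply: measurable_normc_cvec; exact: entire_continuous.
move=> p _; set zeta := cvec p.1 p.2.
have g0 : 0 <= g p.
  by rewrite !mulr_ge0 ?expR_ge0// ltW// w0_cst_gt0.
have f0 : 0 <= f (translate (coords b) p) := fock_density_ge0 _ _.
have h0 : 0 <= normc (E zeta) * w0 zeta.
  by rewrite mulr_ge0 ?normc_ge0// ltW// w0_gt0.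
rewrite !gee0_abs ?lee_fin ?addr_ge0//.
rewrite /f cvec_translate -/zeta /E /recentred_symbol -/b normcM normc_cexp.
set X := normc _; set r := Re _; set A := w0 (b + zeta).
have A0 : 0 < A := w0_gt0 _.
pose Y := expR r * w0 zeta.
have Yg : Y ^+ 2 / A <= g p.
  have c0 := w0_cst_gt0.
  rewrite /Y /A /w0.
  rewrite (_ : _ / _ = (2 * pi) ^- n * expR (exponent zeta)).
    rewrite /g -mulrA ler_pM2l// -expRD ler_expR.
    by apply: le_trans (hK zeta) _; rewrite sqnormc_cvec.
  set c := (2 * pi) ^- n.
  have -> : exponent zeta =
      (r + - (2^-1 * sqnormc zeta)) + (r + - (2^-1 * sqnormc zeta)) -
      (- (2^-1 * sqnormc (b + zeta))) by rewrite /exponent /r; field.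
  rewrite !expRD [expR (- (- _))]expRN; field.
  by rewrite !gt_eqF// expR_gt0.
rewrite -mulrA -/Y; apply: le_trans (_ : X ^+ 2 * A + Y ^+ 2 / A <= _).
  rewrite -(ler_pM2r A0) mulrDl divfK ?gt_eqF//.
  have := sqr_ge0 (X * A - Y); have := sqr_ge0 (X * A + Y).
  nra.
by rewrite lerD2l.
Qed.

End kernel_image.

Section S_op_kernel.
Variables (R : realType) (n : nat).
Local Notation C := R[i].
Local Notation Re := complex.Re.
Local Notation Im := complex.Im.
Local Notation normc := ComplexField.Normc.normc.
Local Notation T := (measurableTypeR R).
Local Notation Tn := (n.-tuple T).
Local Notation Cn := (lebesgue_Cn R n).
Implicit Types (p : Tn * Tn) (z w a b m zeta : 'rV[C]_n).

(** The map [w |-> conjv (a - w)] in real coordinates. *)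
Definition reflect_about a p := translate (coords (conjv a)) (reflect_fst p).

Lemma measure_preserving_reflect_about a :
  measure_preserving Cn (reflect_about a).
Proof.
exact: measure_preserving_comp (measure_preserving_translate _)
  (measure_preserving_reflect_fst R n).
Qed.

Lemma cvec_reflect_about a p :
  cvec (reflect_about a p).1 (reflect_about a p).2 = conjv (a - cvec p.1 p.2).
Proof.
rewrite cvec_translate; apply/rowP => j; rewrite !mxE /= tnth_mktuple.
by case: (a 0 j) => u v /=; simpc; congr (_ +i* _); ring.
Qed.

Lemma gauss_mean (E : 'rV[C]_n -> C) (kappa : R) : entire E ->
  (\int[Cn]_p (w0 (cvec p.1 p.2))%:E = kappa%:E)%E ->
  Cn.-integrable setT
    (fun p => (normc (E (cvec p.1 p.2)) * w0 (cvec p.1 p.2))%:E) ->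
  (\int[Cn]_p (Re (E (cvec p.1 p.2)) * w0 (cvec p.1 p.2))%:E =
    (Re (E 0) * kappa)%:E)%E.
Proof.
move=> dE hk iE.
have mw := @measurable_w0 R n.
have mRe : measurable_fun setT (fun p => Re (E (cvec p.1 p.2))).
  by apply: measurable_Re_cvec; exact: entire_continuous.
rewrite radial_mean//.
- by rewrite hk.
- by move=> c s p cs; rewrite !w0_cvec sqnormr_cmul.
- exact: integrable_w0.
- apply: le_integrable iE => //.
    by apply/measurable_EFinP; exact: measurable_funM.
  move=> p _; have w0 := ltW (w0_gt0 (cvec p.1 p.2)).
  by rewrite lee_fin !normrM ler_wpM2r// (le_trans (normr_Re_le _))// ler_norm.
Qed.

(** The imaginary part of the integral is handled as the real part for the
    entire function [- i * E]. *)
Lemma S_op_kernel (phi : 'rV[C]_n -> C) (kappa : R) z a : fock phi ->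
  (\int[Cn]_p (w0 (cvec p.1 p.2))%:E = kappa%:E)%E ->
  S_op phi (fock_kernel a) z =
  kappa%:C * (phi (z - conjv a) * cexp (2^-1 * dotc z (conjv a))).
Proof.
move=> fphi hk; have [dphi _] := fphi.
pose E := recentred_symbol phi z a.
have dE : entire E := entire_recentred_symbol z a dphi.
pose Ni : C := 0 -i* 1.
pose E' zeta := Ni * E zeta : C.
have dE' : entire E'.
  move=> x.
  exact: (@differentiableZ _ _ _ (E : 'rV[C^o]_n -> C^o) Ni x (dE x)).
have E'Re zeta : Re (E' zeta) = Im (E zeta).
  by rewrite /E' /Ni; case: (E zeta) => u v /=; ring.
have iE := integrable_recentred_symbol fphi z a.
have iE' : Cn.-integrable setT
    (fun p => (normc (E' (cvec p.1 p.2)) * w0 (cvec p.1 p.2))%:E).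
  apply: eq_integrable iE => // p _.
  have ni : normc Ni = 1 by rewrite /= expr0n add0r sqrrN expr1n sqrtr1.
  by rewrite /E' normcM ni mul1r.
have E0 : E 0 = phi (z - conjv a) * cexp (2^-1 * dotc z (conjv a)).
  rewrite /E /recentred_symbol addr0; congr (_ * cexp (_ * _)).
  by rewrite /dotc [X in _ + X]big1 ?addr0// => j _; rewrite mxE mul0r.
have key (F : 'rV[C]_n -> C) : entire F ->
    Cn.-integrable setT
      (fun p => (normc (F (cvec p.1 p.2)) * w0 (cvec p.1 p.2))%:E) ->
    \int[Cn]_p (Re (F (conjv (a - cvec p.1 p.2))) *
      w0 (conjv (a - cvec p.1 p.2)))
    = Re (F 0) * kappa.
  move=> dF iF.
  pose G p := (Re (F (cvec p.1 p.2)) * w0 (cvec p.1 p.2))%:E.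
  have mG : measurable_fun setT G.
    apply/measurable_EFinP; apply: measurable_funM; last exact: measurable_w0.
    by apply: measurable_Re_cvec; exact: entire_continuous.
  have := integral_preserving (measure_preserving_reflect_about a) mG.
  rewrite /G (gauss_mean dF hk iF) => h.
  rewrite -[RHS]/(fine (Re (F 0) * kappa)%:E) -h; congr fine.
  by apply: eq_integral => p _; rewrite cvec_reflect_about.
rewrite -E0 /S_op /cintegral_Cn.
under eq_Rintegral do rewrite S_op_integrand.
under [X in _ +i* X]eq_Rintegral do rewrite S_op_integrand.
have ReM (x : C) (y : R) : Re (x * y%:C) = Re x * y by case: x => u v /=; ring.
have ImM (x : C) (y : R) : Im (x * y%:C) = Im x * y by case: x => u v /=; ring.
under eq_Rintegral do rewrite ReM.
under [X in _ +i* X]eq_Rintegral do rewrite ImM -/E -E'Re.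
rewrite key// key// E'Re -/E; case: (E 0) => u v.
by apply/eqP; rewrite eq_complex /=; apply/andP; split; apply/eqP; ring.
Qed.

End S_op_kernel.

(** * Exponential and Gaussian moments of the symbol *)

Section moments.
Variables (R : realType) (n : nat).
Local Notation C := R[i].
Local Notation Re := complex.Re.
Local Notation Im := complex.Im.
Local Notation normc := ComplexField.Normc.normc.
Local Notation T := (measurableTypeR R).
Local Notation Tn := (n.-tuple T).
Local Notation Cn := (lebesgue_Cn R n).
Implicit Types (p : Tn * Tn) (z w a b m zeta : 'rV[C]_n) (q : Tn).

Lemma sqrte_le_sqr (I : \bar R) (c K : R) : (0 <= I)%E -> 0 <= K ->
  (sqrte I <= c%:E * sqrte K%:E)%E -> (I <= (c ^+ 2 * K)%:E)%E.
Proof.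
case: I => [r| |] //=; rewrite !lee_fin => r0 K0 h.
have s0 := sqrtr_ge0 r.
rewrite -(sqr_sqrtr r0) -[X in _ * X](sqr_sqrtr K0) -exprMn.
by rewrite ler_sqr// nnegrE// (le_trans s0).
Qed.

Lemma kernel_span_fock_kernel a : kernel_span (fock_kernel a).
Proof. by exists 1%N, (fun=> 1), (fun=> a) => w; rewrite big_ord1 mul1r. Qed.

Definition dotr (x y : n.-tuple R) : R := \sum_i tnth x i * tnth y i.

Lemma measurable_dotr d (X : measurableType d) (u v : X -> Tn) :
  measurable_fun setT u -> measurable_fun setT v ->
  measurable_fun setT (fun x => dotr (u x) (v x)).
Proof.
move=> mu mv; apply: measurable_sum => i.
by apply: measurable_funM; exact: measurable_coord.
Qed.

Definition imag_point q : 'rV[C]_n := cvec [tuple 0 | i < n] q.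

(** Complete the square in the exponent: the density of [K_(i q)] in the Fock
    norm is a translated Gaussian. *)
Lemma fock_kernel_density q p :
  normc (fock_kernel (imag_point q) (cvec p.1 p.2)) ^+ 2 * w0 (cvec p.1 p.2) =
  expR (2^-1 * sqnormr q) *
  (w0 (cvec (translate (coords (- imag_point q)) p).1
           (translate (coords (- imag_point q)) p).2)).
Proof.
rewrite cvec_translate /w0 /fock_kernel normc_cexp mulrCA [RHS]mulrCA.
congr (_ * _); rewrite expr2 -!expRD; congr expR.
rewrite !sqnormcE /sqnormr /dotc.
rewrite Re_half raddf_sum !mulr_sumr -!sumrN -!big_split/=.
apply: eq_bigr => i _.
by rewrite !mxE !tnth_mktuple/=; field.
Qed.

(** At [u + conj a] with [a = i q] and [u = x + i y], the factor
    [|e^(z . conj a / 2)| ^+ 2] has exponent [q . y - |q|^2] and the Gaussian has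
    [- |u|^2 / 2 + q . y - |q|^2 / 2]. *)
Lemma S_op_density (phi : 'rV[C]_n -> C) (kappa : R) q p : fock phi ->
  (\int[Cn]_p (w0 (cvec p.1 p.2))%:E = kappa%:E)%E ->
  let p' := translate (coords (conjv (imag_point q))) p in
  normc (S_op phi (fock_kernel (imag_point q)) (cvec p'.1 p'.2)) ^+ 2
    * w0 (cvec p'.1 p'.2) =
  kappa ^+ 2 * expR (- (3 / 2 * sqnormr q)) *
  (normc (phi (cvec p.1 p.2)) ^+ 2 * w0 (cvec p.1 p.2) * expR (2 * dotr q p.2)).
Proof.
move=> fphi hk p'; rewrite (S_op_kernel _ _ fphi hk) /p' cvec_translate.
set a := imag_point q; rewrite [conjv a + _]addrC addrK.
rewrite normcM [normc (phi _ * _)]normcM normc_cexp !exprMn.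
have -> : normc kappa%:C ^+ 2 = kappa ^+ 2.
  by rewrite /= expr0n addr0 sqrtr_sqr real_normK// num_real.
rewrite /w0; set c := (2 * pi) ^- n; set X := normc _ ^+ 2.
transitivity (kappa ^+ 2 * X * c *
  expR (2 * Re (2^-1 * dotc (cvec p.1 p.2 + conjv a) (conjv a)) -
   2^-1 * sqnormc (cvec p.1 p.2 + conjv a))).
  by rewrite expRD [2 * _]mulr_natl mulr2n expRD; ring.
transitivity (kappa ^+ 2 * X * c * expR (- (3 / 2 * sqnormr q)
   - 2^-1 * sqnormc (cvec p.1 p.2) + 2 * dotr q p.2)); last first.
  by rewrite !expRD; ring.
congr (_ * expR _).
rewrite !sqnormcE /sqnormr /dotc /dotr.
rewrite Re_half raddf_sum !mulr_sumr -!sumrN -!big_split/=.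
apply: eq_bigr => i _.
by rewrite !mxE !tnth_mktuple/=; field.
Qed.

(** The boundedness inequality for [K_(i q)], whose left-hand side is computed
    by [S_op_density] and whose right-hand side by [fock_kernel_density], after
    one translation each. *)
Lemma exponential_moment (phi : 'rV[C]_n -> C) :
  fock phi -> S_op_bounded phi -> exists2 M : R, 0 <= M & forall q,
  (\int[Cn]_p (normc (phi (cvec p.1 p.2)) ^+ 2 * w0 (cvec p.1 p.2) *
     expR (2 * dotr q p.2))%:E <= (M * expR (2 * sqnormr q))%:E)%E.
Proof.
move=> fphi [c hc]; have [kappa k0 hk] := @integral_w0 R n.
exists (c ^+ 2 / kappa); first by rewrite divr_ge0 ?sqr_ge0// ltW.
move=> q; set J := (\int[_]_p _)%E.
have [[dS _]] := hc _ (kernel_span_fock_kernel (imag_point q)).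
rewrite /fock_norm /integral_Cn.
have -> : (\int[Cn]_p (normc (fock_kernel (imag_point q) (cvec p.1 p.2)) ^+ 2 *
    w0 (cvec p.1 p.2))%:E = (expR (2^-1 * sqnormr q) * kappa)%:E)%E.
  under eq_integral do rewrite fock_kernel_density EFinM.
  have mw : measurable_fun setT (fun p => (w0 (cvec p.1 p.2))%:E).
    by apply/measurable_EFinP; exact: measurable_w0.
  have w00 p : (0 <= (w0 (cvec p.1 p.2))%:E)%E by rewrite lee_fin ltW// w0_gt0.
  have mT := measure_preserving_translate (coords (- imag_point q)).
  rewrite ge0_integralZl_EFin ?expR_ge0//; last first.
    by apply: (measurableT_comp mw); exact: mT.1.
  by rewrite (ge0_integral_preserving mT mw w00) hk EFinM.
have mD : measurable_fun setT (fun p =>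
   (normc (S_op phi (fock_kernel (imag_point q)) (cvec p.1 p.2)) ^+ 2
    * w0 (cvec p.1 p.2))%:E).
  by apply/measurable_EFinP; exact: measurable_fock_density.
have D0 p :
    (0 <= (normc (S_op phi (fock_kernel (imag_point q)) (cvec p.1 p.2)) ^+ 2
    * w0 (cvec p.1 p.2))%:E)%E.
  by rewrite lee_fin fock_density_ge0.
have mT := measure_preserving_translate (coords (conjv (imag_point q))).
have <- := ge0_integral_preserving mT mD D0.
have mq : measurable_fun setT (fun p => normc (phi (cvec p.1 p.2)) ^+ 2 *
    w0 (cvec p.1 p.2) * expR (2 * dotr q p.2)).
  apply: measurable_funM; first exact: measurable_fock_density fphi.1.
  apply: measurableT_comp => //; apply: measurable_funM => //.
  exact: measurable_dotr.
under eq_integral do rewrite (S_op_density _ _ fphi hk) EFinM.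
rewrite ge0_integralZl_EFin//; last 3 first.
- move=> p _; rewrite lee_fin; apply: mulr_ge0; last exact: expR_ge0.
  exact: fock_density_ge0.
- exact/measurable_EFinP.
- by rewrite mulr_ge0 ?sqr_ge0// expR_ge0.
rewrite -/J => /sqrte_le_sqr h.
have J0 : (0 <= J)%E.
  apply: integral_ge0 => p _.
  rewrite lee_fin; apply: mulr_ge0; last exact: expR_ge0.
  exact: fock_density_ge0.
have A0 : 0 < kappa ^+ 2 * expR (- (3 / 2 * sqnormr q)).
  by rewrite mulr_gt0 ?expR_gt0// exprn_gt0.
have {}h := h (mule_ge0 (ltW A0 : 0%:E <= _%:E)%E J0)
  (mulr_ge0 (expR_ge0 _) (ltW k0)).
rewrite -(@lee_pmul2l _ (kappa ^+ 2 * expR (- (3 / 2 * sqnormr q)))%:E)//.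
apply: le_trans h _; rewrite lee_fin le_eqVlt; apply/orP/or_introl/eqP.
have -> : 2^-1 * sqnormr q = - (3 / 2 * sqnormr q) + 2 * sqnormr q by field.
by rewrite expRD; field; rewrite gt_eqF.
Qed.

(** Average [exponential_moment] over [q] against [e^(- |q|^2 / g)]: the average
    of [e^(2 q . y)] is a multiple of [e^(g |y|^2)], and that of [e^(2 |q|^2)]
    is finite because [1 / g > 2]. *)
Lemma gaussian_moment (phi : 'rV[C]_n -> C) (g : R) :
  fock phi -> S_op_bounded phi -> 0 < g -> g < 2^-1 ->
  (\int[Cn]_p (normc (phi (cvec p.1 p.2)) ^+ 2 * w0 (cvec p.1 p.2) *
     expR (g * sqnormr p.2))%:E < +oo)%E.
Proof.
move=> fphi bphi g0 g2; have [M M0 hM] := exponential_moment fphi bphi.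
pose s := g^-1; have s0 : 0 < s by rewrite invr_gt0.
have s2 : 0 < s - 2 by rewrite subr_gt0 -[ltLHS]invrK ltf_pV2// posrE invr_gt0.
have [K K0 hK] := integral_gauss_Rn n s0.
have [L L0 hL] := integral_gauss_Rn n s2.
pose f p := normc (phi (cvec p.1 p.2)) ^+ 2 * w0 (cvec p.1 p.2).
have f0 p : 0 <= f p := fock_density_ge0 _ _.
have mf : measurable_fun setT f := measurable_fock_density fphi.1.
pose H (pq : (Tn * Tn) * Tn) : \bar R :=
  (f pq.1 * expR (2 * dotr pq.2 pq.1.2 - s * sqnormr pq.2))%:E.
have H0 pq : (0 <= H pq)%E by rewrite lee_fin mulr_ge0 ?expR_ge0.
have mexp : measurable_fun setT (fun p : Tn * Tn => expR (g * sqnormr p.2)).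
  apply: measurableT_comp => //; apply: measurable_funM => //.
  exact: (measurableT_comp (@measurable_sqnormr R n) measurable_snd).
have mh : measurable_fun setT
    (fun pq : (Tn * Tn) * Tn => 2 * dotr pq.2 pq.1.2 - s * sqnormr pq.2).
  apply: measurable_funB.
    apply: measurable_funM => //; apply: measurable_dotr => //.
    exact: measurableT_comp.
  apply: measurable_funM => //.
  exact: (measurableT_comp (@measurable_sqnormr R n) measurable_snd).
have mH : measurable_fun setT H.
  apply/measurable_EFinP; apply: measurable_funM; first exact: measurableT_comp.
  exact: measurableT_comp.
have E p : (\int[lebesgue_Rn R n]_q H (p, q) =
    K%:E * (f p * expR (g * sqnormr p.2))%:E)%E.
  rewrite /H/=; under eq_integral do rewrite EFinM.
  rewrite ge0_integralZl_EFin//; last first.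
    apply/measurable_EFinP; apply: measurableT_comp => //.
    exact: (measurableT_comp mh (pair1_measurable p)).
  rewrite integral_gauss_linear_Rn// hK /s invrK -!EFinM.
  by congr EFin; rewrite [sqnormr _ * g]mulrC; ring.
have : (\int[Cn]_p \int[lebesgue_Rn R n]_q H (p, q) < +oo)%E.
  rewrite -[X in (X < _)%E]/(\int[Cn]_p (fubini_F (lebesgue_Rn R n) H p))%E.
  rewrite fubini_tonelli//.
  apply: (@le_lt_trans _ _
    (\int[lebesgue_Rn R n]_q (M%:E * (expR (- ((s - 2) * sqnormr q)))%:E))%E).
    apply: ge0_le_integral => //.
    - by move=> q _; exact: integral_ge0.
    - exact: measurable_fun_fubini_tonelli_G.
    - apply/measurable_EFinP; apply: measurable_funM => //.
      exact: measurable_gauss_Rn.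
    move=> q _; rewrite /fubini_G.
    rewrite (_ : (\int[_]_p _)%E = ((expR (- (s * sqnormr q)))%:E *
      \int[Cn]_p (f p * expR (2 * dotr q p.2))%:E)%E).
      apply: le_trans (lee_wpmul2l _ (hM q)) _.
        by rewrite lee_fin expR_ge0.
      rewrite -!EFinM lee_fin mulrCA -expRD le_eqVlt; apply/orP/or_introl/eqP.
      by congr (_ * expR _); ring.
    rewrite -ge0_integralZl_EFin ?expR_ge0//; last 2 first.
    - by move=> p _; rewrite lee_fin mulr_ge0// expR_ge0.
    - apply/measurable_EFinP; apply: measurable_funM => //.
      apply: measurableT_comp => //; apply: measurable_funM => //.
      exact: measurable_dotr.
    apply: eq_integral => p _; rewrite -EFinM mulrCA -expRD.
    by rewrite /H /= [- _ + _]addrC.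
  rewrite ge0_integralZl_EFin//; last first.
    by apply/measurable_EFinP; exact: measurable_gauss_Rn.
  by rewrite hL -EFinM ltry.
under eq_integral do rewrite E.
rewrite ge0_integralZl_EFin//; last 3 first.
- by move=> p _; rewrite lee_fin mulr_ge0// expR_ge0.
- by apply/measurable_EFinP; apply: measurable_funM => //; exact: mexp.
- exact: ltW.
set I := (\int[_]_p _)%E => h.
have I0 : (0 <= I)%E.
  by apply: integral_ge0 => p _; rewrite lee_fin mulr_ge0// expR_ge0.
by move: I0 h; case: I => [r _ _|_|//]; rewrite ?ltry// gt0_muley ?lte_fin.
Qed.

End moments.

Theorem theorem1p2 (R : realType) (n : nat) (hn : (0 < n)%N)
    (phi : 'rV[R[i]]_n -> R[i]) (hphi : fock phi) (hS : S_op_bounded phi)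
    (t : R) (ht0 : 0 <= t) (ht : t < 2^-1) :
  (\int[lebesgue_Rn R n]_y \int[lebesgue_Rn R n]_x
     (ComplexField.Normc.normc (phi (cvec x y)) ^+ 2 * w_t t x y)%:E < +oo)%E.
Proof.
pose r := 2 * t / (1 + 2 * t).
have t1 : 0 < 1 + 2 * t by lra.
have r0 : 0 <= r by rewrite divr_ge0//; lra.
have r2 : r < 2^-1 by rewrite ltr_pdivrMr//; lra.
(* any g with r <= g < 1/2 would do, provided that it is positive: r may be 0 *)
pose g := (r + 2^-1) / 2.
have g0 : 0 < g by rewrite /g; lra.
have g2 : g < 2^-1 by rewrite /g; lra.
have rg : r <= g by rewrite /g; lra.
have [dphi _] := hphi.
pose f (p : n.-tuple (measurableTypeR R) * n.-tuple (measurableTypeR R)) :=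
  ComplexField.Normc.normc (phi (cvec p.1 p.2)) ^+ 2 * w_t t p.1 p.2.
have f0 p : 0 <= f p by rewrite mulr_ge0 ?sqr_ge0// mulr_ge0 ?expR_ge0.
have m2 := measurableT_comp (@measurable_sqnormr R n)
  (@measurable_snd _ _ (n.-tuple (measurableTypeR R))
    (n.-tuple (measurableTypeR R))).
have mf : measurable_fun setT f.
  apply: measurable_funM.
    apply: measurable_funX; apply: measurable_normc_cvec.
    exact: entire_continuous.
  apply: measurable_funM; apply: measurableT_comp => //.
    apply: measurable_funN; apply: measurable_funM => //.
    exact: measurable_sqnormr_Cn.
  exact: measurable_funM.
rewrite -[X in (X < _)%E]/(\int[lebesgue_Rn R n]_y
  fubini_G (lebesgue_Rn R n) (EFin \o f) y)%E.
rewrite -fubini_tonelli2//; last first.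
  exact/measurable_EFinP.
have c0 : 0 < (2 * pi) ^+ n :> R by rewrite exprn_gt0// mulr_gt0// pi_gt0.
pose h (p : n.-tuple (measurableTypeR R) * n.-tuple (measurableTypeR R)) :=
  ComplexField.Normc.normc (phi (cvec p.1 p.2)) ^+ 2 * w0 (cvec p.1 p.2) *
     expR (g * sqnormr p.2).
have h0 p : 0 <= h p.
  by apply: mulr_ge0; [exact: fock_density_ge0|exact: expR_ge0].
have mh : measurable_fun setT h.
  apply: measurable_funM; first exact: measurable_fock_density.
  by apply: measurableT_comp => //; exact: measurable_funM.
apply: (@le_lt_trans _ _
  (\int[lebesgue_Cn R n]_p (((2 * pi) ^+ n)%:E * (h p)%:E))%E).
  apply: ge0_le_integral => //.
  - by move=> p _; rewrite lee_fin.
  - exact/measurable_EFinP.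
  - by apply/measurable_EFinP; exact: measurable_funM.
  move=> p _; rewrite lee_fin /f /h w0_cvec /w_t -/r.
  rewrite [leRHS](_ : _ = ComplexField.Normc.normc (phi (cvec p.1 p.2)) ^+ 2 *
     (expR (- (2^-1 * (sqnormr p.1 + sqnormr p.2))) * expR (g * sqnormr p.2))).
    rewrite ler_wpM2l ?sqr_ge0// ler_wpM2l ?expR_ge0// ler_expR ler_wpM2r//.
    by apply: sumr_ge0 => i _; exact: sqr_ge0.
  by field; rewrite gt_eqF.
rewrite ge0_integralZl_EFin//; last 3 first.
- by move=> p _; rewrite lee_fin.
- exact/measurable_EFinP.
- exact: ltW.
rewrite lte_mul_pinfty ?lee_fin ?(ltW c0)//.
exact: gaussian_moment.
Qed.
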